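(* For $k>2$ and a parameter $m$, let $\mathcal{F}_k\subset J^k(\mathbb{R}^2)$ be the system $\{u_{k-i,i}=\lambda^{im+1}/(im+1):0\le i\le k\}$ (the parameter $\lambda$ being eliminated). For generic $m$, the Lie algebra of contact symmetries of $\mathcal{F}_k$ has dimension $k(k+1)/2+4$, and a basis of it consists of the contact vector fields $X_f$ with generating functions $$f\in\{x^iy^j\ (0\le i+j<k),\ u_x,\ u_y,\ (km+1)u-m\,x\,u_x,\ u+m\,y\,u_y\}.$$
   Context: $J^k(\mathbb{R}^2)$ is the jet space of scalar functions $u(x,y)$ with coordinates $u_{ij}=\partial_x^i\partial_y^ju$. A contact vector field on $J^1(\mathbb{R}^2)$ with generating function $f\in C^\infty(J^1)$ is $X_f=-f_{u_x}D^1_x-f_{u_y}D^1_y+f\,\partial_u+D^1_x(f)\partial_{u_x}+D^1_y(f)\partial_{u_y}$, where $D^1_x=\partial_x+u_x\partial_u$, $D^1_y=\partial_y+u_y\partial_u$. A contact symmetry of a system in $J^k$ is a contact vector field whose prolongation to $J^k$ is tangent to the system. *)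

(* Defs.v *)
From HB Require Import structures.
From mathcomp Require Import all_boot all_order all_algebra.
From mathcomp Require Import all_classical all_reals all_analysis.
Set Implicit Arguments. Unset Strict Implicit. Unset Printing Implicit Defensive.
Import Order.TTheory GRing.Theory Num.Theory.
Import numFieldNormedType.Exports.
Local Open Scope ring_scope.

Section Jets.
Variable R : realType.

(* A point of the jet space: coordinates x, y and u_{ij} = d_x^i d_y^j u.
   A point of J^k(R^2) is such a record where only the u_{ij} with i+j<=k
   are relevant; all definitions below only read the coordinates of the
   relevant order. *)
Record jpt := JPt { jx : R; jy : R; ju : nat -> nat -> R }.

Definition jfun := jpt -> R.

Definition pdx (g : jfun) (p : jpt) : R :=
  derive1 (fun t => g (JPt t (jy p) (ju p))) (jx p).
Definition pdy (g : jfun) (p : jpt) : R :=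
  derive1 (fun t => g (JPt (jx p) t (ju p))) (jy p).
Definition pdu (i j : nat) (g : jfun) (p : jpt) : R :=
  derive1 (fun t => g (JPt (jx p) (jy p)
     (fun a b => if (a == i) && (b == j) then t else ju p a b))) (ju p i j).

(* total derivatives of a function depending on coordinates of order <= N *)
Definition Dx (N : nat) (g : jfun) : jfun := fun p =>
  pdx g p + \sum_(a < N.+1) \sum_(b < N.+1 | (a + b <= N)%N)
              ju p a.+1 b * pdu a b g p.
Definition Dy (N : nat) (g : jfun) : jfun := fun p =>
  pdy g p + \sum_(a < N.+1) \sum_(b < N.+1 | (a + b <= N)%N)
              ju p a b.+1 * pdu a b g p.

Fixpoint Dys (N j : nat) (g : jfun) : jfun :=
  if j is j'.+1 then Dy (N + j') (Dys N j' g) else g.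
Fixpoint Dxs (N i : nat) (g : jfun) : jfun :=
  if i is i'.+1 then Dx (N + i') (Dxs N i' g) else g.
Definition Dsig (N i j : nat) (g : jfun) : jfun := Dxs (N + j) i (Dys N j g).

Definition J1 := 'rV[R]_5.
Definition j1x (v : J1) := v ord0 (inord 0).
Definition j1y (v : J1) := v ord0 (inord 1).
Definition j1u (v : J1) := v ord0 (inord 2).
Definition j1ux (v : J1) := v ord0 (inord 3).
Definition j1uy (v : J1) := v ord0 (inord 4).

Definition proj1 (p : jpt) : J1 :=
  \row_(i < 5) nth 0 [:: jx p; jy p; ju p 0 0; ju p 1 0; ju p 0 1] i.
Definition lift1 (f : J1 -> R) : jfun := fun p => f (proj1 p).

Fixpoint Cn (n : nat) (f : J1 -> R) : Prop :=
  if n is n'.+1 then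
    (forall v : J1, differentiable f v) /\ (forall w : J1, Cn n' ('D_w f))
  else continuous f.
Definition smooth (f : J1 -> R) : Prop := forall n, Cn n f.

(* Components of the contact vector field X_f on J^1:
   X_f = xi d_x + eta d_y + phi d_u + ..., where
   xi = -f_{u_x}, eta = -f_{u_y}, phi = f - u_x f_{u_x} - u_y f_{u_y}. *)
Definition cxi (f : J1 -> R) : jfun := fun p => - pdu 1 0 (lift1 f) p.
Definition ceta (f : J1 -> R) : jfun := fun p => - pdu 0 1 (lift1 f) p.
Definition cphi (f : J1 -> R) : jfun := fun p =>
  lift1 f p + cxi f p * ju p 1 0 + ceta f p * ju p 0 1.
Definition cchar (f : J1 -> R) : jfun := fun p =>
  cphi f p - cxi f p * ju p 1 0 - ceta f p * ju p 0 1.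

(* coefficient of d/du_{ij} in the prolongation of X_f (standard
   prolongation formula): D_x^i D_y^j Q + xi u_{i+1,j} + eta u_{i,j+1} *)
Definition prol_coef (f : J1 -> R) (i j : nat) : jfun := fun p =>
  Dsig 1 i j (cchar f) p + cxi f p * ju p i.+1 j + ceta f p * ju p i j.+1.

Definition Fcurve (m : R) (i : nat) (l : R) : R :=
  l `^ (i%:R * m + 1) / (i%:R * m + 1).

Definition inFk (m : R) (k : nat) (l : R) (p : jpt) : Prop :=
  0 < l /\ forall i, (i <= k)%N -> ju p (k - i) i = Fcurve m i l.

(* The prolongation of X_f to J^k is tangent to F_k: at every point p of F_k
   (parameter l) the vector lies in T_p F_k.  F_k is parametrised by the free
   coordinates of order < k together with l, so T_p F_k consists of the
   vectors whose order-k components are a multiple of d/dl of the curve. *)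
Definition contact_symmetry (m : R) (k : nat) (f : J1 -> R) : Prop :=
  forall (l : R) (p : jpt), inFk m k l p ->
    exists c : R, forall i, (i <= k)%N ->
      prol_coef f (k - i) i p = c * derive1 (Fcurve m i) l.

Definition monomial_idx (k : nat) : seq (nat * nat) :=
  [seq (i, j) | i <- iota 0 k, j <- iota 0 (k - i)].
Definition sym_basis (m : R) (k : nat) : seq (J1 -> R) :=
  [seq (fun v : J1 => j1x v ^+ ij.1 * j1y v ^+ ij.2) | ij <- monomial_idx k]
  ++ [:: j1ux; j1uy;
         (fun v => (k%:R * m + 1) * j1u v - m * j1x v * j1ux v);
         (fun v => j1u v + m * j1y v * j1uy v)].

Definition in_span (B : seq (J1 -> R)) (f : J1 -> R) : Prop :=
  exists c : seq R, size c = size B /\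
    forall v, f v = \sum_(b < size B) c`_b * (nth (fun _ => 0) B b) v.

Definition lin_indep (B : seq (J1 -> R)) : Prop :=
  forall c : seq R, size c = size B ->
    (forall v, \sum_(b < size B) c`_b * (nth (fun _ => 0) B b) v = 0) ->
    forall b, (b < size B)%N -> c`_b = 0.

End Jets.

(* Main.v *)
(* Write P, Q, H for f_{u_x}, f_{u_y}, f_u and X, Y for the total derivatives.
   For i + j = n >= 3, modulo functions of jets of order < n,
     X^i Y^j f = P u_{i+1,j} + Q u_{i,j+1} + (H + i XP + j YQ) u_{ij}
                 + j YP u_{i+1,j-1} + i XQ u_{i-1,j+1},
   and the prolongation formula cancels the first two terms.  So, for fixed jets
   of order < k, the prolonged field is affine along F_k, and tangency at the
   components i = 0, 1 is a linear relation between the powers of lambda with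
   exponents 0, 1, m, m+1, 2m+1, which are distinct for generic m.  It gives
   YP = XQ = 0, YQ - XP = m (H + k XP), and the vanishing of the lower order
   part for i = 0.  As k > 2, second derivatives of u are free in the first two
   equations, hence P = P(x) and Q = Q(y); the third one then determines
   H = H(x, y).  The pure derivatives of order k-1 enter the components (1, k-1)
   and (k-1, 1) with coefficients H_x and H_y, which therefore vanish, so P and
   Q are affine and H is constant.  Subtracting a combination of the four
   non-polynomial generators leaves a symmetry g(x, y); tangency says that its
   derivatives of order k are zero, and Taylor's formula shows that it is a
   polynomial of degree < k. *)
Require Import Defs.
From HB Require Import structures.
From mathcomp Require Import all_boot all_order all_algebra.
From mathcomp Require Import all_classical all_reals all_analysis.
From mathcomp Require Import ring lra zify.
Set Implicit Arguments. Unset Strict Implicit. Unset Printing Implicit Defensive.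
Import Order.TTheory GRing.Theory Num.Theory.
Import numFieldNormedType.Exports.
Local Open Scope classical_set_scope.
Local Open Scope ring_scope.

(** * Symmetry of second directional derivatives *)

Lemma ler_dist_half (R : realType) (A B C e : R) :
  `|A - C| < e / 2 -> `|B - C| < e / 2 -> `|A - B| <= e.
Proof.
move=> AC BC; have -> : A - B = A - C - (B - C) by ring.
by rewrite (le_trans (ler_normB _ _))// (splitr e) lerD// ltW.
Qed.

Section Directional.
Variables (R : realType) (V : normedModType R).
Implicit Types (f g : V -> R) (a v w : V).

Lemma is_derive_line f a w (t : R) : derivable f (a + t *: w) w ->
  is_derive t 1 (fun s => f (a + s *: w)) ('D_w f (a + t *: w)).
Proof.
move=> df.
have E : (fun h : R => h^-1 *: ((fun s => f (a + s *: w)) (h *: 1 + t) -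
     (fun s => f (a + s *: w)) t)) =
   (fun h : R => h^-1 *: (f (h *: w + (a + t *: w)) - f (a + t *: w))).
  by apply/funext => h /=; rewrite scalerDl addrCA /GRing.scale /= mulr1.
apply: DeriveDef; first by rewrite /derivable E.
by rewrite /derive E.
Qed.

Lemma derive0_line_cst f a w (t : R) :
  (forall v, derivable f v w) -> (forall v, 'D_w f v = 0) ->
  f (a + t *: w) = f a.
Proof.
move=> df f0.
have H (s : R) : is_derive s (1 : R) (fun s => f (a + s *: w)) 0.
  by rewrite -(f0 (a + s *: w)); exact: is_derive_line.
have := @is_derive_0_is_cst R (fun s => f (a + s *: w)) t 0 H.
by rewrite scale0r addr0.
Qed.

(** The mean value theorem is applied twice: to the difference of [f] along two parallel segments in
    direction [v], then to ['D_v f] along a segment in direction [w]. *)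
Lemma double_difference_MVT f a v w (h : R) : 0 < h ->
  (forall z, derivable f z v) -> (forall z, derivable ('D_v f) z w) ->
  exists s t : R, [/\ 0 < s < h, 0 < t < h &
   f (a + h *: v + h *: w) - f (a + h *: v) - f (a + h *: w) + f a
   = h * h * 'D_w ('D_v f) (a + s *: v + t *: w)].
Proof.
move=> h0 dv dw.
pose phi (s : R) := f ((a + h *: w) + s *: v) - f (a + s *: v).
have dphi (s : R) : is_derive s (1 : R) phi
    ('D_v f ((a + h *: w) + s *: v) - 'D_v f (a + s *: v)).
  by apply: is_deriveB; exact: is_derive_line.
have cphi : {within `[0, h], continuous phi}.
  apply: derivable_within_continuous => s _.
  by have [] := dphi s.
have [s sI es] := MVT h0 (fun s _ => dphi s) cphi.
pose psi (t : R) := 'D_v f ((a + s *: v) + t *: w).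
have dpsi (t : R) : is_derive t (1 : R) psi ('D_w ('D_v f) ((a + s *: v) + t *: w)).
  exact: is_derive_line.
have cpsi : {within `[0, h], continuous psi}.
  apply: derivable_within_continuous => t _.
  by have [] := dpsi t.
have [t tI et] := MVT h0 (fun t _ => dpsi t) cpsi.
exists s, t; split.
- by move: sI; rewrite in_itv.
- by move: tI; rewrite in_itv.
move: es et; rewrite /phi /psi !scale0r !addr0 subr0.
rewrite (addrAC a (h *: w) (h *: v)) (addrAC a (h *: w) (s *: v)) => es et.
rewrite et in es; move: es.
move: (f (a + h *: v + h *: w)) (f (a + h *: v)) (f (a + h *: w)) (f a)
  ('D_w _ _) => A B C D Z E.
have -> : A - B - C + D = A - B - (C - D) by ring.
by rewrite E; ring.
Qed.

(** Schwarz's theorem: the second difference over a small parallelogram is symmetric in [v] and [w],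
    so the two mixed derivatives take a common value at points near [a]; continuity at [a] does the
    rest. *)
Lemma derive_comm f a v w :
  (forall z, derivable f z v) -> (forall z, derivable f z w) ->
  (forall z, derivable ('D_v f) z w) -> (forall z, derivable ('D_w f) z v) ->
  {for a, continuous ('D_w ('D_v f))} -> {for a, continuous ('D_v ('D_w f))} ->
  'D_w ('D_v f) a = 'D_v ('D_w f) a.
Proof.
move=> dv dw dvw dwv c1 c2.
apply/eqP; rewrite -subr_eq0 -normr_le0; apply/ler_addgt0Pr => e e0.
rewrite add0r.
have e2 : 0 < e / 2 by rewrite divr_gt0.
move/cvgrPdist_lt: (c1) => /(_ _ e2) /nbhs_ballP[d1 /= d10 B1].
move/cvgrPdist_lt: (c2) => /(_ _ e2) /nbhs_ballP[d2 /= d20 B2].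
pose d := Num.min d1 d2.
have [dd1 dd2] : d <= d1 /\ d <= d2 by rewrite !ge_min !lexx orbT.
have d0 : 0 < d by rewrite lt_min d10.
(* The summand 1 keeps [N] positive when [v = w = 0]; with [h = d / N] the intermediate points lie
   within distance [d] of [a]. *)
pose N := `|v| + `|w| + 1.
have N0 : 0 < N by rewrite ltr_wpDl// addr_ge0.
pose h := d / N.
have h0 : 0 < h by rewrite divr_gt0.
have small s t v' w' : `|v'| + `|w'| = `|v| + `|w| -> 0 < s < h -> 0 < t < h ->
    `|a - (a + s *: v' + t *: w')| < d.
  move=> Nv /andP[s0 sh] /andP[t0 th].
  rewrite -addrA opprD addrA subrr add0r normrN.
  apply: le_lt_trans (ler_normD _ _) _; rewrite !normrZ !gtr0_norm//.
  apply: (@le_lt_trans _ _ (h * (`|v'| + `|w'|))).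
    by rewrite mulrDr lerD// ler_wpM2r// ltW.
  by rewrite Nv /h -mulrA gtr_pMr// ltr_pdivrMl// mulr1 /N ltrDl.
have [s [t [sI tI E1]]] := double_difference_MVT a h0 dv dvw.
have [s' [t' [sI' tI' E2]]] := double_difference_MVT a h0 dw dwv.
have E : 'D_w ('D_v f) (a + s *: v + t *: w) = 'D_v ('D_w f) (a + s' *: w + t' *: v).
  have hh : h * h != 0 by rewrite mulf_neq0// gt_eqF.
  apply: (mulfI hh); move: E1 E2; rewrite (addrAC a (h *: w) (h *: v)).
  move: ('D_w _ _) ('D_v _ _) (f (a + h *: v + h *: w)) (f (a + h *: v)) (f (a + h *: w)) (f a).
  by move=> ? ? ? ? ? ? <- <-; ring.
have := B1 (a + s *: v + t *: w); have := B2 (a + s' *: w + t' *: v).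
rewrite -!ball_normE /= => H2 H1.
have {}H1 := H1 (lt_le_trans (small _ _ _ _ erefl sI tI) dd1).
have {}H2 := H2 (lt_le_trans (small _ _ _ _ (addrC _ _) sI' tI') dd2).
rewrite E in H1.
exact: ler_dist_half H1 H2.
Qed.

End Directional.

(** * Smooth functions on J^1 *)

(* The coordinates 0, ..., 4 of J1 are x, y, u, u_x, u_y. *)
HB.lock Definition pd (R : realType) (i : nat) (f : J1 R -> R) : J1 R -> R :=
  'D_(delta_mx ord0 (inord i)) f.

Section SmoothFunctions.
Variable R : realType.
Local Notation J := (J1 R).
Implicit Types (f g : J -> R) (v w : J) (n : nat).

Lemma CnW n f : Cn n.+1 f -> Cn n f.
Proof.
elim: n f => [|n IH] f [df Df].
  by move=> v; exact: differentiable_continuous.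
by split=> // w; apply: IH; exact: Df.
Qed.

Lemma derivable_Cn n f v w : Cn n.+1 f -> derivable f v w.
Proof. by move=> [df _]; exact/diff_derivable. Qed.

Lemma CnD n f g : Cn n f -> Cn n g -> Cn n (fun v => f v + g v).
Proof.
elim: n f g => [|n IH] f g Hf Hg.
  by move=> v; apply: continuousD; [exact: Hf|exact: Hg].
split=> [v|w].
  by apply: differentiableD; [exact: Hf.1|exact: Hg.1].
have -> : 'D_w (fun v => f v + g v) = (fun v => 'D_w f v + 'D_w g v).
  by apply/funext => v; apply: deriveD; [exact: derivable_Cn Hf|exact: derivable_Cn Hg].
by apply: IH; [exact: Hf.2|exact: Hg.2].
Qed.

Lemma CnM n f g : Cn n f -> Cn n g -> Cn n (fun v => f v * g v).
Proof.
elim: n f g => [|n IH] f g Hf Hg.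
  by move=> v; apply: continuousM; [exact: Hf|exact: Hg].
split=> [v|w].
  by apply: differentiableM; [exact: Hf.1|exact: Hg.1].
have -> : 'D_w (fun v => f v * g v) = (fun v => f v * 'D_w g v + g v * 'D_w f v).
  by apply/funext => v; apply: deriveM; [exact: derivable_Cn Hf|exact: derivable_Cn Hg].
by apply: CnD; apply: IH; [exact: (CnW Hf)|exact: Hg.2|exact: (CnW Hg)|exact: Hf.2].
Qed.

Lemma smooth_cst (c : R) : smooth (cst c : J -> R).
Proof.
move=> n; elim: n c => [|n IH] c; first exact: cst_continuous.
split=> [v|w]; first exact: differentiable_cst.
rewrite (_ : 'D_w _ = cst 0) //.
by apply/funext => v; rewrite derive_cst.
Qed.

Lemma smoothD f g : smooth f -> smooth g -> smooth (fun v => f v + g v).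
Proof. by move=> Hf Hg n; exact: CnD. Qed.

Lemma smoothM f g : smooth f -> smooth g -> smooth (fun v => f v * g v).
Proof. by move=> Hf Hg n; exact: CnM. Qed.

Lemma smoothZ (c : R) f : smooth f -> smooth (fun v => c * f v).
Proof. by move=> Hf; apply: smoothM => //; exact: smooth_cst. Qed.

Lemma smoothX f n : smooth f -> smooth (fun v => f v ^+ n).
Proof.
move=> Hf; elim: n => [|n IH]; first exact: (smooth_cst 1).
rewrite (_ : (fun v => _) = (fun v => f v * f v ^+ n)); first exact: smoothM.
by apply/funext => v; rewrite exprS.
Qed.

Lemma derive_coord (i : 'I_5) v w : 'D_w (fun u : J => u ord0 i) v = w ord0 i.
Proof.
have /matrixP/(_ ord0 i) := derive_mx (@derivable_id R _ v w).
by rewrite derive_id mxE.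
Qed.

Lemma smooth_coord (i : 'I_5) : smooth (fun u : J => u ord0 i).
Proof.
case=> [|n]; first exact: coord_continuous.
split=> [v|w]; first exact: differentiable_coord.
rewrite (_ : 'D_w _ = cst (w ord0 i)); first exact: smooth_cst.
by apply/funext => v; rewrite derive_coord.
Qed.

Lemma smooth_derivable f v w : smooth f -> derivable f v w.
Proof. by move=> Hf; exact: derivable_Cn (Hf 1%N). Qed.

Lemma smooth_derive f w : smooth f -> smooth ('D_w f).
Proof. by move=> Hf n; exact: (Hf n.+1).2. Qed.

Lemma smooth_derive_comm f v w : smooth f -> 'D_w ('D_v f) = 'D_v ('D_w f).
Proof.
move=> Hf; apply/funext => a.
have Hv := smooth_derive v Hf; have Hw := smooth_derive w Hf.
apply: derive_comm => [z|z|z|z||]; try exact: smooth_derivable.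
- exact: (smooth_derive w Hv 0%N).
- exact: (smooth_derive v Hw 0%N).
Qed.

Lemma smooth_pd i f : smooth f -> smooth (pd i f).
Proof. by rewrite pd.unlock; exact: smooth_derive. Qed.

Lemma pd_comm i j f : smooth f -> pd i (pd j f) = pd j (pd i f).
Proof. by move=> Hf; rewrite pd.unlock; exact: smooth_derive_comm. Qed.

Lemma pd_cst i (c : R) : pd i (cst c) = cst 0.
Proof. by apply/funext => v; rewrite pd.unlock derive_cst. Qed.

Lemma pdD i f g : smooth f -> smooth g ->
  pd i (fun v => f v + g v) = (fun v => pd i f v + pd i g v).
Proof.
by move=> Hf Hg; rewrite pd.unlock; apply/funext => v; apply: deriveD; exact: smooth_derivable.
Qed.

Lemma pdM i f g : smooth f -> smooth g ->
  pd i (fun v => f v * g v) = (fun v => f v * pd i g v + g v * pd i f v).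
Proof.
by move=> Hf Hg; rewrite pd.unlock; apply/funext => v; apply: deriveM; exact: smooth_derivable.
Qed.

Lemma pdZ i (c : R) f : smooth f -> pd i (fun v => c * f v) = (fun v => c * pd i f v).
Proof.
move=> Hf; rewrite (pdM i (smooth_cst c) Hf); apply/funext => v.
by rewrite pd_cst /= mulr0 addr0.
Qed.

Lemma pd_coord i j : (i < 5)%N -> (j < 5)%N ->
  pd i (fun u : J => u ord0 (inord j)) = cst (i == j)%:R.
Proof.
move=> i5 j5; apply/funext => v; rewrite pd.unlock derive_coord mxE eqxx /=.
by rewrite -val_eqE /= !inordK// eq_sym.
Qed.

Lemma pd0_line i f v (t : R) : smooth f -> (forall v, pd i f v = 0) ->
  f (v + t *: delta_mx ord0 (inord i)) = f v.
Proof.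
by rewrite pd.unlock => Hf f0; apply: derive0_line_cst => // w; exact: smooth_derivable.
Qed.

(** The coordinates in [s] are moved to 0 one at a time, each along a line on which [f] is constant.
    For a repeated index the second shift is by 0. *)
Lemma pd0_reset (s : seq 'I_5) f v : smooth f ->
  (forall i, i \in s -> forall v, pd i f v = 0) ->
  f v = f (\row_i (if i \in s then 0 else v ord0 i)).
Proof.
move=> Hf; elim: s v => [|i s IH] v f0.
  by congr f; apply/rowP => i; rewrite mxE.
rewrite IH; last by move=> j js; apply: f0; rewrite in_cons js orbT.
set w := (\row_i _).
rewrite -(pd0_line (i := i) w (- (w ord0 i)) Hf); last by apply: f0; rewrite mem_head.
congr f; apply/rowP => j; rewrite inord_val !mxE eqxx /= in_cons.
have [->|ji] /= := eqVneq j i; first by case: ifP => _; ring.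
by rewrite mulr0 addr0.
Qed.

Lemma pd0_cst f v : smooth f -> (forall i, (i < 5)%N -> forall v, pd i f v = 0) ->
  f v = f 0.
Proof.
move=> Hf f0; rewrite (@pd0_reset (enum 'I_5) f v Hf).
  by congr f; apply/rowP => i; rewrite !mxE mem_enum.
by move=> i _; exact: f0.
Qed.

End SmoothFunctions.

(** * Total derivatives of functions on the jet space *)

(** A common index for the coordinates, which turns [pdx], [pdy] and [pdu] into the single operator
    [jpd]. *)
Inductive jcoord := Cx | Cy | Cu of nat & nat.

Section JetCoordinates.
Variable R : realType.
Implicit Types (f : J1 R -> R) (g h : jfun R) (p q : jpt R) (M n : nat).

Definition jset (c : jcoord) p (t : R) : jpt R :=
  match c with
  | Cx => JPt t (jy p) (ju p)
  | Cy => JPt (jx p) t (ju p)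
  | Cu i j => JPt (jx p) (jy p)
                (fun a b => if (a == i) && (b == j) then t else ju p a b)
  end.

Definition jget (c : jcoord) p : R :=
  match c with Cx => jx p | Cy => jy p | Cu i j => ju p i j end.

Definition jpd (c : jcoord) g p : R :=
  derive1 (fun t => g (jset c p t)) (jget c p).

Definition jderivable g :=
  forall c p, derivable (fun t : R => g (jset c p t)) (jget c p) (1 : R).

(** The image of the coordinate direction [c] under [proj1], hence 0 for jet coordinates of order at
    least 2. *)
Definition jdir (c : jcoord) : J1 R :=
  match c with
  | Cx => delta_mx ord0 (inord 0)
  | Cy => delta_mx ord0 (inord 1)
  | Cu 0 0 => delta_mx ord0 (inord 2)
  | Cu 1 0 => delta_mx ord0 (inord 3)
  | Cu 0 1 => delta_mx ord0 (inord 4)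
  | _ => 0
  end.

Lemma proj1_jset c p (t : R) :
  proj1 (jset c p t) = proj1 p + (t - jget c p) *: jdir c.
Proof.
have io (k : nat) (hk : (k < 5)%N) (i : 'I_5) : (i == inord k) = (val i == k).
  by rewrite -val_eqE /= inordK.
apply/rowP => i; rewrite !mxE.
case: c => [||[|[|a]] [|[|b]]] /=; rewrite ?mxE ?eqxx /= ?io //;
  case: i => [[|[|[|[|[|//]]]]] ?] /=; by rewrite ?mulr0 ?mulr1 ?addr0 // addrC subrK.
Qed.

Lemma is_derive_lift1 c p f : smooth f ->
  is_derive (jget c p) (1 : R) (fun t : R => lift1 f (jset c p t))
    ('D_(jdir c) f (proj1 p)).
Proof.
move=> Hf; rewrite /lift1.
have -> : (fun t => f (proj1 (jset c p t))) =
   (fun t => f ((proj1 p - jget c p *: jdir c) + t *: jdir c)).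
  by apply/funext => t; rewrite proj1_jset scalerBl addrA addrAC.
have := @is_derive_line R _ f (proj1 p - jget c p *: jdir c) (jdir c) (jget c p).
by rewrite subrK; apply; exact: smooth_derivable.
Qed.

Lemma is_derive_ju c p a b :
  is_derive (jget c p) (1 : R) (fun t : R => ju (jset c p t) a b)
    (if c is Cu i j then ((i == a) && (j == b))%:R else 0).
Proof.
case: c => [||i j] /=; try exact: is_derive_cst.
rewrite [i == a]eq_sym [j == b]eq_sym; case: andP => [_|_].
- exact: is_derive_id.
- exact: is_derive_cst.
Qed.

Lemma jderivable_lift1 f : smooth f -> jderivable (lift1 f).
Proof. by move=> Hf c p; have [] := is_derive_lift1 c p Hf. Qed.

Lemma jderivable_ju a b : jderivable (fun p => ju p a b).
Proof. by move=> c p; have [] := is_derive_ju c p a b. Qed.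

Lemma jderivableD g h : jderivable g -> jderivable h ->
  jderivable (fun p => g p + h p).
Proof. by move=> Hg Hh c p; exact: derivableD. Qed.

Lemma jderivableM g h : jderivable g -> jderivable h ->
  jderivable (fun p => g p * h p).
Proof. by move=> Hg Hh c p; exact: derivableM. Qed.

Lemma jset_jget c p : jset c p (jget c p) = p.
Proof.
case: c p => [||i j] [x y u] //=; congr JPt.
by apply/funext => a; apply/funext => b; case: andP => [[/eqP -> /eqP ->]|].
Qed.

Lemma jpdD c g h p : jderivable g -> jderivable h ->
  jpd c (fun p => g p + h p) p = jpd c g p + jpd c h p.
Proof.
by move=> Hg Hh; rewrite /jpd !derive1E; exact: (deriveD (Hg c p) (Hh c p)).
Qed.

Lemma jpdM c g h p : jderivable g -> jderivable h ->
  jpd c (fun p => g p * h p) p = g p * jpd c h p + jpd c g p * h p.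
Proof.
move=> Hg Hh; rewrite /jpd !derive1E (deriveM (Hg c p) (Hh c p)).
by rewrite !jset_jget [X in _ + X]mulrC.
Qed.

Lemma jpd_lift1 c f p : smooth f -> jpd c (lift1 f) p = 'D_(jdir c) f (proj1 p).
Proof.
by move=> Hf; rewrite /jpd derive1E; have [] := is_derive_lift1 c p Hf.
Qed.

Lemma jpd_ju c p a b : jpd c (fun p => ju p a b) p =
  if c is Cu i j then ((i == a) && (j == b))%:R else 0.
Proof. by rewrite /jpd derive1E; have [] := is_derive_ju c p a b. Qed.

End JetCoordinates.

Arguments jdir {R} c.

(* d = true is the x direction and d = false the y direction; booleans are
   coerced to 0 and 1, so (d, ~~ d) is the multi-index of the direction. *)
HB.lock Definition jD (R : realType) (M : nat) (d : bool) : jfun R -> jfun R :=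
  if d then Dx M else Dy M.

Section TotalDerivative.
Variable R : realType.
Implicit Types (f : J1 R -> R) (g h : jfun R) (p q : jpt R) (M n : nat).

Lemma jDE M d g p : jD M d g p = jpd (if d then Cx else Cy) g p +
  \sum_(a < M.+1) \sum_(b < M.+1 | (a + b <= M)%N)
     ju p (d + a) (~~ d + b) * jpd (Cu a b) g p.
Proof. by rewrite jD.unlock; case: d. Qed.

Lemma jD_add M d g h : jderivable g -> jderivable h ->
  jD M d (fun p => g p + h p) = (fun p => jD M d g p + jD M d h p).
Proof.
move=> Hg Hh; apply/funext => p; rewrite !jDE jpdD// addrACA; congr (_ + _).
rewrite -big_split /=; apply: eq_bigr => a _.
rewrite -big_split /=; apply: eq_bigr => b _.
by rewrite jpdD// mulrDr.
Qed.

Lemma jD_mul M d g h : jderivable g -> jderivable h ->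
  jD M d (fun p => g p * h p) = (fun p => g p * jD M d h p + jD M d g p * h p).
Proof.
move=> Hg Hh; apply/funext => p; rewrite !jDE jpdM// mulrDr mulrDl addrACA.
congr (_ + _); rewrite mulr_sumr mulr_suml -big_split /=; apply: eq_bigr => a _.
rewrite mulr_sumr mulr_suml -big_split /=; apply: eq_bigr => b _.
by rewrite jpdM// mulrDr mulrCA [X in _ + X]mulrA.
Qed.

Lemma sum_pick M (F : nat -> nat -> R) i j : (i + j <= M)%N ->
  \sum_(a < M.+1) \sum_(b < M.+1 | (a + b <= M)%N)
     F a b * ((a == i :> nat) && (b == j :> nat))%:R = F i j.
Proof.
move=> ij.
have iM : (i < M.+1)%N by lia.
have jM : (j < M.+1)%N by lia.
rewrite (bigD1 (Ordinal iM)) //= [X in _ + X]big1 ?addr0 => [|a ai].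
  rewrite (bigD1 (Ordinal jM)) //= [X in _ + X]big1 ?addr0 => [|b /andP[_ bj]].
    by rewrite !eqxx mulr1.
  by move: bj; rewrite -val_eqE /= => /negbTE ->; rewrite andbF mulr0.
by rewrite big1 // => b _; move: ai; rewrite -val_eqE /= => /negbTE ->; rewrite mulr0.
Qed.

Lemma jD_ju M d a b : (a + b <= M)%N ->
  jD M d (fun p => ju p a b) = (fun p => ju p (d + a) (~~ d + b)).
Proof.
move=> abM; apply/funext => p; rewrite jDE jpd_ju.
rewrite (_ : (if if d then _ else _ is Cu _ _ then _ else _) = 0); last by case: d.
rewrite add0r -[RHS](sum_pick (fun a b => ju p (d + a) (~~ d + b)) abM).
by apply: eq_bigr => i _; apply: eq_bigr => j _; rewrite jpd_ju.
Qed.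

Lemma derive_jdir_Cu a b f v : 'D_(jdir (Cu a b)) f v =
  pd 2 f v * ((a == 0) && (b == 0))%N%:R +
  pd 3 f v * ((a == 1) && (b == 0))%N%:R +
  pd 4 f v * ((a == 0) && (b == 1))%N%:R.
Proof.
have -> : 'D_(jdir (Cu a b)) f v = if (a == 0)%N && (b == 0)%N then pd 2 f v else
    if (a == 1)%N && (b == 0)%N then pd 3 f v else
    if (a == 0)%N && (b == 1)%N then pd 4 f v else 0.
  by rewrite pd.unlock; case: a => [|[|a]]; case: b => [|[|b]] //; exact: derive0.
move: (pd 2 f v) (pd 3 f v) (pd 4 f v) => A B C.
by case: a => [|[|a]]; case: b => [|[|b]] /=; ring.
Qed.

(** Only [u], [u_x] and [u_y] contribute to the sum over jet coordinates, and [0 < M] ensures that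
    all three occur in it. *)
Lemma jD_lift1 M d f : smooth f -> (0 < M)%N ->
  jD M d (lift1 f) = (fun p => lift1 (pd (~~ d) f) p +
     ju p d (~~ d) * lift1 (pd 2 f) p + ju p (d + 1) (~~ d) * lift1 (pd 3 f) p
     + ju p d (~~ d + 1) * lift1 (pd 4 f) p).
Proof.
move=> Hf M0; apply/funext => p; rewrite jDE jpd_lift1// -!addrA; congr (_ + _).
  by rewrite pd.unlock; case: d.
pose F a b : R := ju p (d + a) (~~ d + b).
have -> : \sum_(a < M.+1) \sum_(b < M.+1 | (a + b <= M)%N)
     ju p (d + a) (~~ d + b) * jpd (Cu a b) (lift1 f) p =
   \sum_(a < M.+1) \sum_(b < M.+1 | (a + b <= M)%N)
     ((F a b * pd 2 f (proj1 p)) * ((a == 0%N :> nat) && (b == 0%N :> nat))%:R +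
      ((F a b * pd 3 f (proj1 p)) * ((a == 1%N :> nat) && (b == 0%N :> nat))%:R +
      (F a b * pd 4 f (proj1 p)) * ((a == 0%N :> nat) && (b == 1%N :> nat))%:R)).
  apply: eq_bigr => a _; apply: eq_bigr => b _; rewrite jpd_lift1//.
  by rewrite derive_jdir_Cu !mulrDr !mulrA -addrA.
under eq_bigr do rewrite big_split /= big_split /=.
rewrite big_split /= big_split /=.
rewrite (sum_pick (fun a b => F a b * pd 2 f (proj1 p)))//.
rewrite (sum_pick (fun a b => F a b * pd 3 f (proj1 p)))//.
rewrite (sum_pick (fun a b => F a b * pd 4 f (proj1 p)))//.
by rewrite /F !addn0.
Qed.

(** For [n > 0], a syntactic class of functions on J^n: polynomials in the jet coordinates of order
    at most [n] with coefficients lifted from J^1. It is large enough for iterated total derivatives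
    and allows proofs by induction. *)
Inductive ord n : jfun R -> Prop :=
| ord_lift1 f : smooth f -> (0 < n)%N -> ord n (lift1 f)
| ord_ju a b : (a + b <= n)%N -> ord n (fun p => ju p a b)
| ord_add g h : ord n g -> ord n h -> ord n (fun p => g p + h p)
| ord_mul g h : ord n g -> ord n h -> ord n (fun p => g p * h p).

Lemma ord_jderivable n g : ord n g -> jderivable g.
Proof.
elim=> {g} [f Hf _|a b _|g h _ Hg _ Hh|g h _ Hg _ Hh].
- exact: jderivable_lift1.
- exact: jderivable_ju.
- exact: jderivableD.
- exact: jderivableM.
Qed.

Lemma ord_mono m n g : (m <= n)%N -> ord m g -> ord n g.
Proof.
move=> mn; elim=> {g} [f Hf m0|a b ab|g h _ Hg _ Hh|g h _ Hg _ Hh].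
- by apply: ord_lift1 => //; exact: leq_trans m0 mn.
- by apply: ord_ju; exact: leq_trans ab mn.
- exact: ord_add.
- exact: ord_mul.
Qed.

Lemma ord_cst n (c : R) : (0 < n)%N -> ord n (fun=> c).
Proof. exact: (ord_lift1 (smooth_cst c)). Qed.

Lemma ord_scale n (c : R) g : (0 < n)%N -> ord n g -> ord n (fun p => c * g p).
Proof. by move=> n0 Hg; apply: ord_mul => //; exact: ord_cst. Qed.

Definition jagree n p q := [/\ jx p = jx q, jy p = jy q &
  forall a b, (a + b <= n)%N -> ju p a b = ju q a b].

Lemma proj1_jagree n p q : (0 < n)%N -> jagree n p q -> proj1 p = proj1 q.
Proof. by move=> n0 [ex ey eu]; rewrite /proj1 ex ey !eu. Qed.

Lemma ord_jagree n g p q : ord n g -> jagree n p q -> g p = g q.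
Proof.
move=> + pq; elim=> {g} [f Hf n0|a b ab|g h _ Hg _ Hh|g h _ Hg _ Hh].
- by rewrite /lift1 (proj1_jagree n0 pq).
- by case: pq => _ _; exact.
- by rewrite Hg Hh.
- by rewrite Hg Hh.
Qed.

Lemma ord_jD M n d g : (0 < n <= M)%N -> ord n g -> ord n.+1 (jD M d g).
Proof.
move=> /andP[n0 nM]; elim=> {g} [f Hf _|a b ab|g h Og Hg Oh Hh|g h Og Hg Oh Hh].
- rewrite jD_lift1//; last exact: leq_trans n0 nM.
  by do ?[apply: ord_add|apply: ord_mul|apply: ord_lift1|apply: ord_ju
    |apply: smooth_pd] => //; case: d; lia.
- rewrite jD_ju; last exact: leq_trans ab nM.
  by apply: ord_ju; case: d => /=; lia.
- by rewrite (jD_add _ _ (ord_jderivable Og) (ord_jderivable Oh)); exact: ord_add.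
- rewrite (jD_mul _ _ (ord_jderivable Og) (ord_jderivable Oh)).
  by apply: ord_add; apply: ord_mul => //; exact: ord_mono (leqnSn n) _.
Qed.

(** Higher coordinates do not occur in [g], so the point of truncation is immaterial from [n] on.
    This permits one fixed bound [M] for all iterates. *)
Lemma jD_trunc M n d g : (0 < n <= M)%N -> ord n g -> jD n d g = jD M d g.
Proof.
move=> /andP[n0 nM]; elim=> {g} [f Hf _|a b ab|g h Og Hg Oh Hh|g h Og Hg Oh Hh].
- by rewrite !jD_lift1//; exact: leq_trans n0 nM.
- by rewrite !jD_ju//; exact: leq_trans ab nM.
- by rewrite !(jD_add _ _ (ord_jderivable Og) (ord_jderivable Oh)) Hg Hh.
- by rewrite !(jD_mul _ _ (ord_jderivable Og) (ord_jderivable Oh)) Hg Hh.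
Qed.

End TotalDerivative.

(** * Leading terms of iterated total derivatives *)

Section Expansion.
Variables (R : realType) (M : nat).
Implicit Types (f : J1 R -> R) (g h : jfun R) (p q : jpt R) (n : nat) (d : bool).

Local Notation D := (jD M).

(** Differentiability and the value of the derivative travel together, so that Leibniz computations
    can be assembled as proof terms. *)
Definition tder d g g' := jderivable g /\ D d g = g'.

Lemma tderE d g g' : tder d g g' -> D d g = g'.
Proof. by case. Qed.

Lemma tder_eq d g g' h : tder d g g' -> g' =1 h -> tder d g h.
Proof. by move=> [Hg <-] E; split => //; apply/funext. Qed.

Lemma tder_ord n d g : ord n g -> tder d g (D d g).
Proof. by move=> Og; split => //; exact: ord_jderivable Og. Qed.

Lemma tder_lift1 d f : smooth f -> tder d (lift1 f) (D d (lift1 f)).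
Proof. by move=> Hf; split => //; exact: jderivable_lift1. Qed.

Lemma tder_ju d a b : (a + b <= M)%N ->
  tder d (fun p => ju p a b) (fun p => ju p (d + a) (~~ d + b)).
Proof. by move=> ab; split; [exact: jderivable_ju|exact: jD_ju]. Qed.

Lemma tder_add d g g' h h' : tder d g g' -> tder d h h' ->
  tder d (fun p => g p + h p) (fun p => g' p + h' p).
Proof.
by move=> [Hg <-] [Hh <-]; split; [exact: jderivableD|rewrite jD_add].
Qed.

Lemma tder_mul d g g' h h' : tder d g g' -> tder d h h' ->
  tder d (fun p => g p * h p) (fun p => g p * h' p + g' p * h p).
Proof.
by move=> [Hg <-] [Hh <-]; split; [exact: jderivableM|rewrite jD_mul].
Qed.

Lemma tder_cst d (c : R) : (0 < M)%N -> tder d (fun=> c) (fun=> 0).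
Proof.
move=> M0; have Hc := @smooth_cst R c.
split; first exact: (jderivable_lift1 Hc).
rewrite (jD_lift1 d Hc M0); apply/funext => p.
by rewrite /lift1 !pd_cst /= !mulr0 !addr0.
Qed.

Lemma tder_scale d (c : R) g g' : (0 < M)%N -> tder d g g' ->
  tder d (fun p => c * g p) (fun p => c * g' p).
Proof.
move=> M0 Hg; apply: tder_eq (tder_mul (tder_cst d c M0) Hg) _ => p.
by rewrite mul0r addr0.
Qed.

Local Notation P f := (lift1 (pd 3 f)).
Local Notation Q f := (lift1 (pd 4 f)).
Local Notation H f := (lift1 (pd 2 f)).
Local Notation T d f := (lift1 (pd (~~ d) f)).

Lemma D_lift1 d f p : smooth f -> (0 < M)%N -> D d (lift1 f) p =
  T d f p + ju p d (~~ d) * H f p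
     + ju p (d + 1) (~~ d) * P f p + ju p d (~~ d + 1) * Q f p.
Proof. by move=> Hf M0; rewrite jD_lift1. Qed.

Lemma D2_lift1E e1 e2 f : smooth f -> (1 < M)%N ->
  D e1 (D e2 (lift1 f)) = fun p => D e1 (T e2 f) p +
     (ju p e2 (~~ e2) * D e1 (H f) p + ju p (e1 + e2) (~~ e1 + ~~ e2) * H f p) +
     (ju p (e2 + 1) (~~ e2) * D e1 (P f) p + ju p (e1 + (e2 + 1)) (~~ e1 + ~~ e2) * P f p) +
     (ju p e2 (~~ e2 + 1) * D e1 (Q f) p + ju p (e1 + e2) (~~ e1 + (~~ e2 + 1)) * Q f p).
Proof.
move=> Hf M1.
have c0 : (e2 + ~~ e2 <= M)%N by case: (e2); lia.
have c1 : (e2 + 1 + ~~ e2 <= M)%N by case: (e2) => /=; lia.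
have c2 : (e2 + (~~ e2 + 1) <= M)%N by case: (e2) => /=; lia.
have L (F : J1 R -> R) : smooth F -> tder e1 (lift1 F) (D e1 (lift1 F)).
  exact: tder_lift1.
rewrite [D e2 _]jD_lift1//; last by lia.
exact: (tderE (tder_add (tder_add (tder_add (L _ (smooth_pd (~~ e2) Hf))
  (tder_mul (tder_ju e1 c0) (L _ (smooth_pd 2 Hf))))
  (tder_mul (tder_ju e1 c1) (L _ (smooth_pd 3 Hf))))
  (tder_mul (tder_ju e1 c2) (L _ (smooth_pd 4 Hf))))).
Qed.

(** Jets of order 3 arise only when the outer derivation hits a second-order coordinate, and the
    coefficients of those are [P] and [Q]. *)
Lemma D2_lift1 d1 d2 f : smooth f -> (2 < M)%N -> exists2 r, ord 2 r &
  D d1 (D d2 (lift1 f)) = fun p =>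
    P f p * ju p (d1 + d2 + 1) (~~ d1 + ~~ d2) +
    Q f p * ju p (d1 + d2) (~~ d1 + ~~ d2 + 1) + r p.
Proof.
move=> Hf M2; have M0 : (0 < M)%N by lia.
pose t p := T d2 f p + ju p d2 (~~ d2) * H f p.
have Ot : ord 1 t.
  by do ?[apply: ord_add|apply: ord_mul|apply: ord_lift1|apply: ord_ju|apply: smooth_pd];
    rewrite // ; case: (d2).
have e : D d2 (lift1 f) = fun p => t p + ju p (d2 + 1) (~~ d2) * P f p
            + ju p d2 (~~ d2 + 1) * Q f p.
  by apply/funext => p; rewrite D_lift1.
exists (fun p => D d1 t p + (ju p (d2 + 1) (~~ d2) * D d1 (P f) p
            + ju p d2 (~~ d2 + 1) * D d1 (Q f) p)).
  apply: ord_add; first by apply: ord_jD => //; lia.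
  by apply: ord_add; apply: ord_mul; 
    [apply: ord_ju; case: (d2)|apply: ord_jD; rewrite ?M0//; apply: ord_lift1 => //; exact: smooth_pd
    |apply: ord_ju; case: (d2)|apply: ord_jD; rewrite ?M0//; apply: ord_lift1 => //; exact: smooth_pd].
rewrite e; apply: tderE.
have b1 : (d2 + 1 + ~~ d2 <= M)%N by case: (d2) => /=; lia.
have b2 : (d2 + (~~ d2 + 1) <= M)%N by case: (d2) => /=; lia.
apply: tder_eq (tder_add (tder_add (tder_ord d1 Ot)
  (tder_mul (tder_ju d1 b1) (tder_lift1 d1 (smooth_pd 3 Hf))))
  (tder_mul (tder_ju d1 b2) (tder_lift1 d1 (smooth_pd 4 Hf)))) _ => p.
rewrite !addnA.
ring.
Qed.

(** Base case of the leading-term formula: all jets of order 3 and 4 are kept explicitly. *)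
Lemma D3_lift1 d1 d2 d3 f : smooth f -> (4 <= M)%N -> exists2 r, ord 2 r &
  D d1 (D d2 (D d3 (lift1 f))) = fun p =>
    P f p * ju p (d1 + d2 + d3 + 1) (~~ d1 + ~~ d2 + ~~ d3) +
    Q f p * ju p (d1 + d2 + d3) (~~ d1 + ~~ d2 + ~~ d3 + 1) +
    H f p * ju p (d1 + d2 + d3) (~~ d1 + ~~ d2 + ~~ d3) +
    (D d1 (P f) p * ju p (d2 + d3 + 1) (~~ d2 + ~~ d3) +
     D d2 (P f) p * ju p (d1 + d3 + 1) (~~ d1 + ~~ d3) +
     D d3 (P f) p * ju p (d1 + d2 + 1) (~~ d1 + ~~ d2)) +
    (D d1 (Q f) p * ju p (d2 + d3) (~~ d2 + ~~ d3 + 1) +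
     D d2 (Q f) p * ju p (d1 + d3) (~~ d1 + ~~ d3 + 1) +
     D d3 (Q f) p * ju p (d1 + d2) (~~ d1 + ~~ d2 + 1)) + r p.
Proof.
move=> Hf M4; have M0 : (0 < M)%N by lia.
have M2 : (2 < M)%N by lia.
have HT := smooth_pd (~~ d3) Hf; have HH := smooth_pd 2 Hf.
have HP := smooth_pd 3 Hf; have HQ := smooth_pd 4 Hf.
have [rT OT eT] := D2_lift1 d1 d2 HT M2.
have [rH OH eH] := D2_lift1 d1 d2 HH M2.
have [rP OP eP] := D2_lift1 d1 d2 HP M2.
have [rQ OQ eQ] := D2_lift1 d1 d2 HQ M2.
have bu (a b : bool) c : (c <= 2)%N -> (a + ~~ a + (b + ~~ b) + c <= M)%N.
  by case: a; case: b => /=; lia.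
have c0 : (d3 + ~~ d3 <= M)%N by have := bu d3 d3 0%N isT; lia.
have c1 : (d3 + 1 + ~~ d3 <= M)%N by have := bu d3 d3 1%N isT; lia.
have c2 : (d3 + (~~ d3 + 1) <= M)%N by have := bu d3 d3 1%N isT; lia.
have O1 (F : J1 R -> R) d : smooth F -> ord 2 (D d (lift1 F)).
  by move=> HF; apply: ord_jD; rewrite ?M0//; exact: ord_lift1.
have e23 : D d2 (D d3 (lift1 f)) = fun p => D d2 (T d3 f) p +
   (ju p d3 (~~ d3) * D d2 (H f) p + ju p (d2 + d3) (~~ d2 + ~~ d3) * H f p) +
   (ju p (d3 + 1) (~~ d3) * D d2 (P f) p + ju p (d2 + (d3 + 1)) (~~ d2 + ~~ d3) * P f p) +
   (ju p d3 (~~ d3 + 1) * D d2 (Q f) p + ju p (d2 + d3) (~~ d2 + (~~ d3 + 1)) * Q f p).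
  by rewrite D2_lift1E//; lia.
exists (fun p => rT p + ju p d3 (~~ d3) * rH p + ju p (d3 + 1) (~~ d3) * rP p
   + ju p d3 (~~ d3 + 1) * rQ p + (ju p (d2 + d3) (~~ d2 + ~~ d3) * D d1 (H f) p
   + ju p (d1 + d3) (~~ d1 + ~~ d3) * D d2 (H f) p)).
  have u2 a b : (a + b <= 2)%N -> ord 2 (fun p => ju p a b) by exact: ord_ju.
  apply: ord_add; last first.
    by apply: ord_add; (apply: ord_mul; last exact: O1); apply: u2;
      case: (d1); case: (d2); case: (d3).
  do 3?[apply: ord_add] => //; apply: ord_mul => //; apply: u2; by case: (d3).
rewrite e23; apply: tderE.
have TD F d : smooth F -> tder d1 (D d (lift1 F)) (D d1 (D d (lift1 F))).
  by move=> HF; exact: tder_ord (O1 F d HF).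
have b1 : (d2 + d3 + (~~ d2 + ~~ d3) <= M)%N by have := bu d2 d3 0%N isT; lia.
have b2 : (d2 + (d3 + 1) + (~~ d2 + ~~ d3) <= M)%N by have := bu d2 d3 1%N isT; lia.
have b3 : (d2 + d3 + (~~ d2 + (~~ d3 + 1)) <= M)%N by have := bu d2 d3 1%N isT; lia.
have A (F : J1 R -> R) a b a' b' : smooth F -> (a + b <= M)%N -> (a' + b' <= M)%N ->
   tder d1 (fun p => ju p a b * D d2 (lift1 F) p + ju p a' b' * lift1 F p)
     (fun p => (ju p a b * D d1 (D d2 (lift1 F)) p + ju p (d1 + a) (~~ d1 + b) * D d2 (lift1 F) p)
      + (ju p a' b' * D d1 (lift1 F) p + ju p (d1 + a') (~~ d1 + b') * lift1 F p)).
  by move=> HF ab ab'; apply: tder_add; apply: tder_mul;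
    [exact: tder_ju|exact: TD|exact: tder_ju|exact: tder_lift1].
apply: tder_eq (tder_add (tder_add (tder_add (TD _ d2 HT) (A _ _ _ _ _ HH c0 b1))
  (A _ _ _ _ _ HP c1 b2)) (A _ _ _ _ _ HQ c2 b3)) _ => p.
(* The third-order terms of [eT], [eH], [eP] and [eQ] supply the four summands of [D d3 P] and of
   [D d3 Q], once partial derivatives of [f] are commuted. *)
rewrite eT eH eP eQ !addnA.
rewrite (D_lift1 d3 p HP M0) (D_lift1 d3 p HQ M0).
rewrite (pd_comm 3 _ Hf) (pd_comm 4 (~~ d3) Hf) (pd_comm 3 2 Hf) (pd_comm 4 2 Hf).
rewrite (pd_comm 4 3 Hf).
ring.
Qed.

End Expansion.

(** * Leading terms of any order, and the prolongation coefficients *)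

Section Expansion2.
Variables (R : realType) (M : nat).
Implicit Types (f : J1 R -> R) (g h : jfun R) (p q : jpt R) (n : nat) (d : bool).

Local Notation D := (jD M).
Local Notation P f := (lift1 (pd 3 f)).
Local Notation Q f := (lift1 (pd 4 f)).
Local Notation H f := (lift1 (pd 2 f)).
Local Notation T d f := (lift1 (pd (~~ d) f)).

Lemma tder_jux a b : (a + b <= M)%N ->
  tder M true (fun p : jpt R => ju p a b) (fun p => ju p a.+1 b).
Proof. exact: tder_ju. Qed.

(* X^i Y^j (lift1 f) modulo functions of jets of order < i + j. *)
Definition topform i j f p :=
  P f p * ju p i.+1 j + Q f p * ju p i j.+1 +
  (H f p + i%:R * D true (P f) p + j%:R * D false (Q f) p) * ju p i j +
  j%:R * D false (P f) p * ju p i.+1 j.-1 +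
  i%:R * D true (Q f) p * ju p i.-1 j.+1.

(** When X differentiates [P] and [Q] in the first two terms, the factors [i] of XP and XQ become
    [i + 1]. The other coefficients have order 2, so their derivatives have order 3 and go into the
    remainder, as [2 < i + j]. *)
Lemma topform_step i j f r : smooth f -> (0 < i)%N -> (2 < i + j)%N ->
  (i + j + 2 <= M)%N -> ord (i + j).-1 r ->
  exists2 r', ord (i + j) r' &
    D true (fun p => topform i j f p + r p) = fun p => topform i.+1 j f p + r' p.
Proof.
move=> Hf i0 ij3 ijM Or; have M0 : (0 < M)%N by lia.
have HH := smooth_pd 2 Hf; have HP := smooth_pd 3 Hf; have HQ := smooth_pd 4 Hf.
have O1 F : smooth F -> ord 2 (lift1 F) by move=> HF; exact: ord_lift1.
have O2 F d : smooth F -> ord 2 (D d (lift1 F)).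
  by move=> HF; apply: ord_jD; rewrite ?M0//; exact: ord_lift1.
pose c p := H f p + i%:R * D true (P f) p + j%:R * D false (Q f) p.
have Oc : ord 2 c.
  by apply: ord_add; [apply: ord_add|]; [exact: O1|apply: ord_scale => //; exact: O2
    |apply: ord_scale => //; exact: O2].
pose a p := j%:R * D false (P f) p; pose b p := i%:R * D true (Q f) p.
have Oa : ord 2 a by apply: ord_scale => //; exact: O2.
have Ob : ord 2 b by apply: ord_scale => //; exact: O2.
have O3 g : ord 2 g -> ord (i + j) (D true g).
  by move=> Og; apply: ord_mono ij3 _; apply: ord_jD => //; lia.
have Or1 : ord (i + j) (D true r).
  by rewrite (_ : (i + j = (i + j).-1.+1)%N); [apply: ord_jD => //; lia|lia].
exists (fun p => D true r p + D true c p * ju p i j + D true a p * ju p i.+1 j.-1 +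
    D true b p * ju p i.-1 j.+1).
  apply: ord_add; last by apply: ord_mul; [exact: O3|apply: ord_ju; lia].
  apply: ord_add; first by apply: ord_add => //; apply: ord_mul; [exact: O3|exact: ord_ju].
  (* For [j = 0] the truncated [j.-1] leaves a coordinate of too high order [i + 1], but its
     coefficient has the factor [j] and vanishes. *)
  case: (j) @a Oa ij3 O3 => [|j'] a Oa ij3 O3; last first.
    by apply: ord_mul; [exact: O3|apply: ord_ju => /=; lia].
  rewrite (_ : (fun _ => _) = fun=> 0); first by apply: ord_cst; lia.
  apply/funext => p; rewrite (_ : a = fun=> 0); last first.
    by apply/funext => q; rewrite /a mul0r.
  by rewrite (tderE (tder_cst true 0 M0)) mul0r.
have bij : (i + j <= M)%N by lia.
have b1 : (i.+1 + j <= M)%N by lia.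
have b2 : (i + j.+1 <= M)%N by lia.
have b3 : (i.+1 + j.-1 <= M)%N by lia.
have b4 : (i.-1 + j.+1 <= M)%N by lia.
apply: tderE; apply: tder_eq (tder_add (tder_add (tder_add (tder_add (tder_add
  (tder_mul (tder_lift1 M true HP) (tder_jux b1))
  (tder_mul (tder_lift1 M true HQ) (tder_jux b2)))
  (tder_mul (tder_ord M true Oc) (tder_jux bij)))
  (tder_mul (tder_ord M true Oa) (tder_jux b3)))
  (tder_mul (tder_ord M true Ob) (tder_jux b4))) (tder_ord M true Or)) _ => p.
rewrite [in RHS]/topform prednK//=.
move: (D true c p) (D true a p) (D true b p) => c' a' b'; rewrite /c /a /b.
ring.
Qed.

Lemma expand_x n f : smooth f -> (2 < n)%N -> (n + 2 <= M)%N ->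
  exists2 r, ord n.-1 r &
    iter n (D true) (lift1 f) = fun p => topform n 0 f p + r p.
Proof.
move=> Hf; elim: n => // n IH; rewrite ltnS leq_eqVlt => /orP[/eqP <-|n2] nM.
  have [r Or e] := D3_lift1 true true true Hf (leq_trans (isT : (4 <= 5)%N) nM).
  exists r => //; apply/funext => p; have {e} := congr1 (@^~ p) e.
  rewrite /topform /= => e; apply: etrans e _.
  change (P f p * ju p 4 0 + Q f p * ju p 3 1 + H f p * ju p 3 0 +
   (D true (P f) p * ju p 3 0 + D true (P f) p * ju p 3 0 + D true (P f) p * ju p 3 0) +
   (D true (Q f) p * ju p 2 1 + D true (Q f) p * ju p 2 1 + D true (Q f) p * ju p 2 1)
   + r p = P f p * ju p 4 0 + Q f p * ju p 3 1 +
   (H f p + 3%:R * D true (P f) p + 0%:R * D false (Q f) p) * ju p 3 0 +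
   0%:R * D false (P f) p * ju p 4 0 + 3%:R * D true (Q f) p * ju p 2 1 + r p).
  ring.
have [|r Or e] := IH n2; first by lia.
have n0 : (0 < n)%N by lia.
have [|||r' Or' e'] := @topform_step n 0 f r Hf n0; rewrite ?addn0//; try lia.
by exists r'; [move: Or'; rewrite addn0|rewrite iterS e].
Qed.

(** One derivative in y suffices, since the determining equations are read off from the components 0
    and 1. *)
Lemma expand_xy n f : smooth f -> (1 < n)%N -> (n + 3 <= M)%N ->
  exists2 r, ord n r &
    iter n (D true) (D false (lift1 f)) = fun p => topform n 1 f p + r p.
Proof.
move=> Hf; elim: n => // n IH; rewrite ltnS leq_eqVlt => /orP[/eqP <-|n2] nM.
  have [r Or e] := D3_lift1 true true false Hf (leq_trans (isT : (4 <= 5)%N) nM).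
  exists r => //; apply/funext => p; have {e} := congr1 (@^~ p) e.
  rewrite /topform /= => e; apply: etrans e _.
  change (P f p * ju p 3 1 + Q f p * ju p 2 2 + H f p * ju p 2 1 +
   (D true (P f) p * ju p 2 1 + D true (P f) p * ju p 2 1 + D false (P f) p * ju p 3 0) +
   (D true (Q f) p * ju p 1 2 + D true (Q f) p * ju p 1 2 + D false (Q f) p * ju p 2 1)
   + r p = P f p * ju p 3 1 + Q f p * ju p 2 2 +
   (H f p + 2%:R * D true (P f) p + 1%:R * D false (Q f) p) * ju p 2 1 +
   1%:R * D false (P f) p * ju p 3 0 + 2%:R * D true (Q f) p * ju p 1 2 + r p).
  ring.
have [|r Or e] := IH n2; first by lia.
have n0 : (0 < n)%N by lia.
have [|||r' Or' e'] := @topform_step n 1 f r Hf n0; rewrite ?addn1//; try lia.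
by exists r'; [move: Or'; rewrite addn1|rewrite iterS e].
Qed.

Lemma ord_iter n d i g : (0 < n)%N -> (n + i <= M.+1)%N -> ord n g ->
  ord (n + i) (iter i (D d) g).
Proof.
move=> n0; elim: i => [|i IH] niM Og; first by rewrite addn0.
by rewrite addnS iterS; apply: ord_jD; [lia|apply: IH => //; lia].
Qed.

Lemma DxE n g : Dx n g = jD n true g. Proof. by rewrite jD.unlock. Qed.

Lemma DyE n g : Dy n g = jD n false g. Proof. by rewrite jD.unlock. Qed.

(** Each truncation order in [Dsig] bounds the order of the function it is applied to, so [jD_trunc]
    replaces all of them by [M]. *)
Lemma DsigE i j g : ord 1 g -> (i + j <= M)%N ->
  Dsig 1 i j g = iter i (D true) (iter j (D false) g).
Proof.
move=> Og ijM.
have Oy : ord (1 + j) (iter j (D false) g) by apply: ord_iter => //; lia.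
have Ey : Dys 1 j g = iter j (D false) g.
  have: (j <= M)%N by lia.
  elim: (j) => // n IH nM; rewrite iterS /= IH; last by lia.
  rewrite DyE; apply: jD_trunc; first by lia.
  by apply: ord_iter => //; lia.
rewrite /Dsig Ey; have: (i + j <= M)%N by [].
elim: (i) => // n IH nM; rewrite iterS /= IH; last by lia.
rewrite DxE; apply: jD_trunc; first by lia.
by apply: ord_iter => //; lia.
Qed.

(** The characteristic [cchar f] is [f] itself. The subtracted terms are the first two of [topform],
    so the jets of order [i + j + 1] will cancel. *)
Lemma prol_coefE f i j p : smooth f -> (i + j <= M)%N ->
  prol_coef f i j p = iter i (D true) (iter j (D false) (lift1 f)) p
    - P f p * ju p i.+1 j - Q f p * ju p i j.+1.
Proof.
move=> Hf ijM; rewrite /prol_coef.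
have -> : cchar f = lift1 f by apply/funext => q; rewrite /cchar /cphi; ring.
rewrite DsigE//; last exact: ord_lift1.
have -> : cxi f p = - P f p.
  by congr (- _); rewrite pd.unlock; exact: (jpd_lift1 (Cu 1 0) p Hf).
have -> : ceta f p = - Q f p.
  by congr (- _); rewrite pd.unlock; exact: (jpd_lift1 (Cu 0 1) p Hf).
by rewrite !mulNr.
Qed.

(** On [lift1 f] this reduces to the symmetry of second partial derivatives; the Leibniz rule
    extends it to sums and products. *)
Lemma D_comm n d1 d2 g : (0 < n < M)%N -> ord n g ->
  D d1 (D d2 g) = D d2 (D d1 g).
Proof.
move=> /andP[n0 nM].
have M0 : (0 < M)%N by lia.
have OD d h : ord n h -> ord n.+1 (D d h) by apply: ord_jD; lia.
elim=> {g} [f Hf _|a b ab|g h Og Hg Oh Hh|g h Og Hg Oh Hh].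
- have M1 : (1 < M)%N by lia.
  rewrite !D2_lift1E//; apply/funext => p.
  do 8?rewrite D_lift1//; try exact: smooth_pd.
  rewrite (pd_comm (~~ d1) (~~ d2) Hf) !(pd_comm _ 2 Hf) !(pd_comm _ 3 Hf)
    !(pd_comm _ 4 Hf).
  rewrite (addnC d2 d1) (addnC (~~ d2) (~~ d1)).
  rewrite !addnA (addnC d2 d1) (addnC (~~ d2) (~~ d1)).
  ring.
- rewrite !jD_ju//; try lia.
  by rewrite !addnA (addnC d2) (addnC (~~ d2)).
- by rewrite !(tderE (tder_add (tder_ord M _ Og) (tder_ord M _ Oh)))
    !(tderE (tder_add (tder_ord M _ (OD _ _ Og)) (tder_ord M _ (OD _ _ Oh)))) Hg Hh.
- rewrite !(tderE (tder_mul (tder_ord M _ Og) (tder_ord M _ Oh))).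
  have E e1 e2 := tderE (tder_add (tder_mul (tder_ord M e1 Og) (tder_ord M e1 (OD e2 _ Oh)))
    (tder_mul (tder_ord M e1 (OD e2 _ Og)) (tder_ord M e1 Oh))).
  by rewrite !E Hg Hh; apply/funext => p; ring.
Qed.

End Expansion2.

(** * Expansions for f_{u_x} depending on x, f_{u_y} on y, and f_u on x and y only *)

Section AffineGenerators.
Variables (R : realType) (M : nat).
Implicit Types (f : J1 R -> R) (g h r : jfun R) (p q : jpt R) (n : nat) (d : bool).

Local Notation D := (jD M).
Local Notation P f := (lift1 (pd 3 f)).
Local Notation Q f := (lift1 (pd 4 f)).
Local Notation H f := (lift1 (pd 2 f)).

(** Jets of order [n + 1] arise only by shifting an index in direction [d]: a derivative in y, for
    instance, never produces u_{n+1,0}. *)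
Lemma jD_indep n d g p q : (0 < n <= M)%N -> ord n g ->
  jx p = jx q -> jy p = jy q ->
  (forall a b, (a + b <= n)%N || (d <= a)%N && (~~ d <= b)%N && (a + b <= n.+1)%N ->
     ju p a b = ju q a b) ->
  D d g p = D d g q.
Proof.
move=> /andP[n0 nM] + ex ey eu.
have ag : jagree n p q by split=> // a b ab; apply: eu; rewrite ab.
elim=> {g} [f Hf _|a b ab|g h Og Hg Oh Hh|g h Og Hg Oh Hh].
- have M0 : (0 < M)%N by lia.
  rewrite !D_lift1// /lift1 (proj1_jagree n0 ag).
  by rewrite !eu //; apply/orP; right; case: (d); rewrite /= ?addn0 ?add0n; lia.
- have abM : (a + b <= M)%N by lia.
  rewrite !jD_ju//; apply: eu; apply/orP; right.
  by case: (d); rewrite /= ?add1n ?add0n; lia.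
- by rewrite !(tderE (tder_add (tder_ord M d Og) (tder_ord M d Oh))) Hg Hh.
- rewrite !(tderE (tder_mul (tder_ord M d Og) (tder_ord M d Oh))) Hg Hh.
  by rewrite (ord_jagree Og ag) (ord_jagree Oh ag).
Qed.

Variable f : J1 R -> R.
Hypothesis Hf : smooth f.
Hypothesis hP : forall i, (0 < i < 5)%N -> pd i (pd 3 f) = cst 0.
Hypothesis hQ : forall i, (i != 1)%N -> (i < 5)%N -> pd i (pd 4 f) = cst 0.
Hypothesis hH : forall i, (1 < i < 5)%N -> pd i (pd 2 f) = cst 0.

(** [A] and [F] treat both directions at once: [A d] is P or Q, and [F d] is its derivative in its
    own variable. *)
Let A d := if d then pd 3 f else pd 4 f.
Let F d := pd (~~ d) (A d).

Let smA d : smooth (A d). Proof. by case: d; exact: smooth_pd. Qed.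
Let smF d : smooth (F d). Proof. exact: smooth_pd. Qed.

Lemma D_self d : (0 < M)%N -> D d (lift1 (A d)) = lift1 (F d).
Proof.
move=> M0; apply/funext => p; rewrite D_lift1//.
rewrite /F /A; case: (d) => /=.
  by rewrite (hP (i := 2))// (hP (i := 3))// (hP (i := 4))// /lift1/= !mulr0 !addr0.
by rewrite (hQ (i := 2))// (hQ (i := 3))// (hQ (i := 4))// /lift1/= !mulr0 !addr0.
Qed.

Lemma D_other d : (0 < M)%N -> D d (lift1 (A (~~ d))) = fun=> 0.
Proof.
move=> M0; apply/funext => p; rewrite D_lift1//.
rewrite /A; case: (d) => /=.
  rewrite (hQ (i := 0))// (hQ (i := 2))// (hQ (i := 3))// (hQ (i := 4))//.
  by rewrite /lift1/= !mulr0 !addr0.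
rewrite (hP (i := 1))// (hP (i := 2))// (hP (i := 3))// (hP (i := 4))//.
by rewrite /lift1/= !mulr0 !addr0.
Qed.

Lemma D_H d : (0 < M)%N -> D d (H f) = lift1 (pd (~~ d) (pd 2 f)).
Proof.
move=> M0; apply/funext => p; rewrite D_lift1//; last exact: smooth_pd.
by rewrite (hH (i := 2))// (hH (i := 3))// (hH (i := 4))// /lift1/= !mulr0 !addr0.
Qed.

(** Under the present hypotheses the expansion starts at [n = 2], which is needed for order [k - 1]
    when [k = 3]. The term with the derivative of [A (~~ d)] drops out by [D_other]. *)
Lemma pure_expand d n : (1 < n)%N -> (n + 2 <= M)%N ->
  exists2 r, ord n.-1 r &
    iter n (D d) (lift1 f) = fun p =>
      lift1 (A d) p * ju p (d * n.+1) (~~ d * n.+1) +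
      lift1 (A (~~ d)) p * ju p (d * n + ~~ d) (~~ d * n + d) +
      (H f p + n%:R * lift1 (F d) p) * ju p (d * n) (~~ d * n) + r p.
Proof.
elim: n => // n IH; rewrite ltnS leq_eqVlt => /orP[/eqP <-|n1] nM.
  have M0 : (0 < M)%N by lia.
  exists (fun p => lift1 (pd (~~ d) (pd (~~ d) f)) p +
     (ju p d (~~ d) * lift1 (pd 2 (pd (~~ d) f)) p +
      ju p d (~~ d) * lift1 (pd (~~ d) (pd 2 f)) p)).
    by apply: ord_add; [|apply: ord_add; apply: ord_mul];
      [apply: ord_lift1|apply: ord_ju; case: (d)|apply: ord_lift1
      |apply: ord_ju; case: (d)|apply: ord_lift1] => //; do ?apply: smooth_pd.
  rewrite /= D2_lift1E//; last by lia.
  apply/funext => p; rewrite D_H// (D_lift1 d p (smooth_pd (~~ d) Hf) M0).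
  rewrite (pd_comm 3 _ Hf) (pd_comm 4 (~~ d) Hf).
  case: (d) => /=.
  - rewrite (D_self true M0) (D_other true M0) /A /F /= (hQ (i := 0))//.
    change (lift1 (cst 0) p) with (0 : R).
    change (lift1 (pd 0 (pd 0 f)) p + ju p 1 0 * H (pd 0 f) p + ju p 2 0 * lift1 (pd 0 (pd 3 f)) p + ju p 1 1 * 0 +
     (ju p 1 0 * lift1 (pd 0 (pd 2 f)) p + ju p 2 0 * H f p) +
     (ju p 2 0 * lift1 (pd 0 (pd 3 f)) p + ju p 3 0 * P f p) + (ju p 1 1 * 0 + ju p 2 1 * Q f p) =
     P f p * ju p 3 0 + Q f p * ju p 2 1 + (H f p + 2%:R * lift1 (pd 0 (pd 3 f)) p) * ju p 2 0 +
     (lift1 (pd 0 (pd 0 f)) p + (ju p 1 0 * H (pd 0 f) p + ju p 1 0 * lift1 (pd 0 (pd 2 f)) p))).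
    ring.
  - rewrite (D_self false M0) (D_other false M0) /A /F /= (hP (i := 1))//.
    change (lift1 (cst 0) p) with (0 : R).
    change (lift1 (pd 1 (pd 1 f)) p + ju p 0 1 * H (pd 1 f) p + ju p 1 1 * 0 + ju p 0 2 * lift1 (pd 1 (pd 4 f)) p +
     (ju p 0 1 * lift1 (pd 1 (pd 2 f)) p + ju p 0 2 * H f p) +
     (ju p 1 1 * 0 + ju p 1 2 * P f p) + (ju p 0 2 * lift1 (pd 1 (pd 4 f)) p + ju p 0 3 * Q f p) =
     Q f p * ju p 0 3 + P f p * ju p 1 2 + (H f p + 2%:R * lift1 (pd 1 (pd 4 f)) p) * ju p 0 2 +
     (lift1 (pd 1 (pd 1 f)) p + (ju p 0 1 * H (pd 1 f) p + ju p 0 1 * lift1 (pd 1 (pd 2 f)) p))).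
    ring.
have [|r Or e] := IH n1; first by lia.
have M0 : (0 < M)%N by lia.
have HH := smooth_pd 2 Hf.
pose c p := H f p + n%:R * lift1 (F d) p.
have Oc : ord 1 c.
  by apply: ord_add; [exact: ord_lift1|apply: ord_scale => //; exact: ord_lift1].
have Odc : ord n (D d c) by apply: (ord_mono n1); apply: ord_jD => //; lia.
have Or1 : ord n (D d r).
  by rewrite (_ : n = n.-1.+1); [apply: ord_jD => //; lia|lia].
exists (fun p => D d c p * ju p (d * n) (~~ d * n) + D d r p).
  by apply: ord_add => //; apply: ord_mul => //; apply: ord_ju; case: (d) => /=; lia.
rewrite iterS e.
have b1 : (d * n.+1 + ~~ d * n.+1 <= M)%N by case: (d) => /=; lia.
have b2 : (d * n + ~~ d + (~~ d * n + d) <= M)%N by case: (d) => /=; lia.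
have b3 : (d * n + ~~ d * n <= M)%N by case: (d) => /=; lia.
apply: tderE; apply: tder_eq (tder_add (tder_add (tder_add
  (tder_mul (tder_lift1 M d (smA d)) (@tder_ju R M d _ _ b1))
  (tder_mul (tder_lift1 M d (smA (~~ d))) (@tder_ju R M d _ _ b2)))
  (tder_mul (tder_ord M d Oc) (@tder_ju R M d _ _ b3))) (tder_ord M d Or)) _ => p.
rewrite (D_self d M0) (D_other d M0) !addnA -!mulnS /c -natr1.
ring.
Qed.

(* Only the term with pd d (pd 2 f) contains the pure derivative of order n in
   the direction d, by jD_indep. *)
Lemma mixed_expand d n : (1 < n)%N -> (n + 2 <= M)%N ->
  exists2 r, ord n.-1 r &
    D (~~ d) (iter n (D d) (lift1 f)) = fun p =>
      lift1 (A d) p * ju p (~~ d + d * n.+1) (d + ~~ d * n.+1) +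
      lift1 (A (~~ d)) p * ju p (~~ d + (d * n + ~~ d)) (d + (~~ d * n + d)) +
      (H f p + n%:R * lift1 (F d) p + lift1 (F (~~ d)) p)
         * ju p (~~ d + d * n) (d + ~~ d * n) +
      lift1 (pd d (pd 2 f)) p * ju p (d * n) (~~ d * n) + D (~~ d) r p.
Proof.
move=> n1 nM; have [r Or e] := pure_expand d n1 nM; exists r => //; rewrite e.
have M0 : (0 < M)%N by lia.
have HH := smooth_pd 2 Hf.
have b1 : (d * n.+1 + ~~ d * n.+1 <= M)%N by case: (d) => /=; lia.
have b2 : (d * n + ~~ d + (~~ d * n + d) <= M)%N by case: (d) => /=; lia.
have b3 : (d * n + ~~ d * n <= M)%N by case: (d) => /=; lia.
(* [F d] depends on the base variable of direction [d] only, so in the other direction only [H]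
   contributes. *)
have Dc : tder M (~~ d) (fun p => H f p + n%:R * lift1 (F d) p)
    (lift1 (pd d (pd 2 f))).
  apply: tder_eq (tder_add (tder_lift1 M _ HH)
    (tder_scale n%:R M0 (tder_lift1 M (~~ d) (smF d)))) _ => p.
  rewrite D_H// negbK (D_lift1 _ _ (smF d) M0) negbK.
  have z i : (i < 5)%N -> (i != ~~ d)%N -> pd i (F d) = cst 0.
    move=> i5 id; rewrite /F pd_comm//.
    have -> : pd i (A d) = cst 0.
      by move: id; rewrite /A; case: (d) => /= id; [apply: hP|apply: hQ] => //; lia.
    by rewrite pd_cst.
  by rewrite !z//; [rewrite /lift1/= !mulr0 !addr0 mulr0 addr0|case: (d)..].
have E := tderE (tder_add (tder_add (tder_add
  (tder_mul (tder_lift1 M (~~ d) (smA d)) (@tder_ju R M (~~ d) _ _ b1))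
  (tder_mul (tder_lift1 M (~~ d) (smA (~~ d))) (@tder_ju R M (~~ d) _ _ b2)))
  (tder_mul Dc (@tder_ju R M (~~ d) _ _ b3))) (tder_ord M (~~ d) Or)).
rewrite E; apply/funext => p.
have := D_other (~~ d) M0; rewrite negbK => ->.
rewrite (D_self (~~ d) M0).
have -> : ju p (d * n + ~~ d) (~~ d * n + d) = ju p (~~ d + d * n) (d + ~~ d * n).
  by rewrite addnC [X in ju p _ X]addnC.
ring.
Qed.

End AffineGenerators.

(** * Tangency conditions *)

Section Powers.
Variable R : realType.

Lemma powR_inj (l a b : R) : 1 < l -> l `^ a = l `^ b -> a = b.
Proof.
move=> l1 /(congr1 (@ln R)); rewrite !ln_powR => /mulIf; apply.
by rewrite gt_eqF// ln_gt0.
Qed.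

(** The relation at [2 * l] minus [2 ^ e] times the relation at [l] removes the exponent [e] and
    multiplies the other coefficients by nonzero factors, so induction kills them; the last one is
    read off at [l = 1]. *)
Lemma powR_lin_indep (s : seq (R * R)) : uniq [seq ce.2 | ce <- s] ->
  (forall l : R, 0 < l -> \sum_(ce <- s) ce.1 * l `^ ce.2 = 0) ->
  all (fun ce => ce.1 == 0) s.
Proof.
have [n] := ubnP (size s); elim: n s => // n IH [//|[c e] s] /= sn /andP[es us] s0.
pose s' := [seq (ce.1 * (2 `^ ce.2 - 2 `^ e), ce.2) | ce <- s].
have /IH : (size s' < n)%N by rewrite size_map.
rewrite -map_comp => /(_ us) As'.
have {}As : all (fun ce => ce.1 == 0) s.
  have : all (fun ce => ce.1 == 0) s'.
    apply: As' => l l0; rewrite big_map /=.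
    have l20 : 0 < 2 * l by rewrite mulr_gt0.
    have := s0 _ l20; have := s0 _ l0; rewrite !big_cons /= => E1 E2.
    have -> : \sum_(j <- s) j.1 * (2 `^ j.2 - 2 `^ e) * l `^ j.2 =
       \sum_(j <- s) j.1 * (2 * l) `^ j.2 - 2 `^ e * \sum_(j <- s) j.1 * l `^ j.2.
      rewrite mulr_sumr -sumrB; apply: eq_bigr => j _.
      by rewrite powRM ?ltW//; ring.
    move: E2; rewrite (powRM _ (ltW (ltr0n _ 2))) ?(ltW l0) // => E2.
    move: E1 E2 => /eqP; rewrite addrC addr_eq0 => /eqP -> /eqP.
    by rewrite addrC addr_eq0 => /eqP ->; ring.
  rewrite all_map => /allP H; apply/allP => ce ces.
  have := H _ ces; rewrite /= mulf_eq0 subr_eq0 => /orP[//|/eqP E].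
  have E' := powR_inj (ltr1n R 2) E.
  by move: es; rewrite -E' map_f.
rewrite As andbT; have := s0 1 ltr01; rewrite big_cons big1_seq => [|ce /andP[_ ces]].
  by rewrite powR1 mulr1 addr0 => /eqP.
by rewrite (eqP (allP As _ ces)) mul0r.
Qed.

Lemma derive1_Fcurve (m l : R) i : 0 < l -> i%:R * m + 1 != 0 ->
  derive1 (Fcurve m i) l = l `^ (i%:R * m).
Proof.
move=> l0 im; rewrite derive1E.
have D := is_derive1_powR (i%:R * m + 1) l0.
have -> : Fcurve m i = ((i%:R * m + 1)^-1 \*: (@powR R ^~ (i%:R * m + 1))).
  by apply/funext => x; rewrite /Fcurve mulrC.
have := is_deriveZ (i%:R * m + 1)^-1 D => Z.
by rewrite derive_val /GRing.scale /= addrK mulrA mulVf// mul1r.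
Qed.

Lemma Fcurve0 (m l : R) : 0 < l -> Fcurve m 0 l = l.
Proof. by move=> l0; rewrite /Fcurve mul0r add0r divr1 powRr1// ltW. Qed.

End Powers.

(** * The determining equations *)

Section Tangency.
Variables (R : realType) (k : nat) (m : R).
Hypothesis k2 : (2 < k)%N.
Hypothesis m0 : m != 0.
Hypothesis m1 : m != 1.
Hypothesis mk : forall i, (i <= k.+1)%N -> i%:R * m + 1 != 0.
Variable f : J1 R -> R.
Hypothesis Hf : smooth f.
Hypothesis Sf : contact_symmetry m k f.

Local Notation M := (k + 3)%N.
Local Notation D := (jD M).
Local Notation P := (lift1 (pd 3 f)).
Local Notation Q := (lift1 (pd 4 f)).
Local Notation H := (lift1 (pd 2 f)).

(** Shows that the jets of order below [k] are free on F_k: they are kept from [p] while those of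
    order [k] are put on the curve. *)
Definition jcurve (l : R) (p : jpt R) : jpt R :=
  JPt (jx p) (jy p) (fun a b => if (a + b == k)%N then Fcurve m b l else ju p a b).

Lemma inFk_jcurve l p : 0 < l -> inFk m k l (jcurve l p).
Proof. by move=> l0; split=> // i ik /=; rewrite subnK// eqxx. Qed.

Lemma jagree_jcurve l p : jagree k.-1 (jcurve l p) p.
Proof. by split=> // a b ab /=; case: eqP => // ?; lia. Qed.

(** The curve has speed 1 in component 0, so the unknown factor [c] equals that component and is
    eliminated. *)
Lemma tangency l p i : inFk m k l p -> (i <= k)%N ->
  prol_coef f (k - i) i p = prol_coef f k 0 p * l `^ (i%:R * m).
Proof.
move=> Fp ik; have [c Hc] := Sf Fp; have l0 := Fp.1.
have mk' j : (j <= k)%N -> j%:R * m + 1 != 0 by move=> jk; apply: mk; lia.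
have := Hc 0%N isT; rewrite subn0 derive1_Fcurve ?mk'// mul0r powRr0 mulr1 => ->.
by rewrite Hc// derive1_Fcurve ?mk'.
Qed.

Lemma determining_equations : exists2 r0, ord k.-1 r0 &
  [/\ iter k (D true) (lift1 f) = (fun p => topform M k 0 f p + r0 p),
     forall p, r0 p = 0, forall p, D false P p = 0, forall p, D true Q p = 0 &
     forall p, D false Q p - D true P p = m * (H p + k%:R * D true P p)].
Proof.
have [|r0 O0 e0] := expand_x Hf k2 (M := M); first by lia.
have [||r1 O1 e1] := expand_xy (n := k.-1) Hf (M := M); try lia.
exists r0 => //.
have HP := smooth_pd 3 Hf; have HQ := smooth_pd 4 Hf; have HH := smooth_pd 2 Hf.
suff main p : [/\ r0 p = 0, D false P p = 0, D true Q p = 0 &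
     D false Q p - D true P p = m * (H p + k%:R * D true P p)].
  by split => // p; have [] := main p.
have O2 d (F : J1 R -> R) : smooth F -> ord k.-1 (D d (lift1 F)).
  move=> HF; apply: (@ord_mono _ 2); first by lia.
  by apply: ord_jD; [lia|exact: ord_lift1].
have OH : ord k.-1 H by apply: ord_lift1 => //; lia.
have pt (l : R) : 0 < l -> exists q, [/\ inFk m k l q, ju q k 0 = l,
    ju q k.-1 1 = Fcurve m 1 l, ju q k.-2 2 = Fcurve m 2 l &
    forall g, ord k.-1 g -> g q = g p].
  move=> l0; exists (jcurve l p); split=> [||||g Og]; first exact: inFk_jcurve.
  - by rewrite /= addn0 eqxx Fcurve0.
  - by rewrite /= (_ : (k.-1 + 1 == k)%N = true)//; lia.
  - by rewrite /= (_ : (k.-2 + 2 == k)%N = true)//; lia.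
  - exact: ord_jagree Og (jagree_jcurve l p).
(* Component 1 against component 0 at the point [q] over [p]: only the jets of order [k] vary with
   [l], and those of order [k + 1] cancel. *)
have E (l : R) : 0 < l ->
   (H p + k.-1%:R * D true P p + D false Q p) * Fcurve m 1 l +
     D false P p * l + k.-1%:R * D true Q p * Fcurve m 2 l + r1 p
   = ((H p + k%:R * D true P p) * l + k%:R * D true Q p * Fcurve m 1 l + r0 p) * l `^ m.
  move=> l0; have [q [Fq U0 U1 U2 ev]] := pt l l0.
  have := tangency Fq (leq_trans (isT : (1 <= 3)%N) k2).
  rewrite mul1r !(prol_coefE (M := M))//; try lia.
  have ks : (k - 1)%N = k.-1 by lia.
  have kk : k.-1.+1 = k by lia.
  rewrite ks /= e0 e1 /topform kk /= U0 U1 U2.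
  rewrite !(ev _ (O2 _ _ HP)) !(ev _ (O2 _ _ HQ)) (ev _ OH) (ev _ O0) (ev _ O1).
  move: (ju q k.+1 0) (ju q k 1) (ju q k.-1 2).
  move: (H p) (D true P p) (D false P p) (D true Q p) (D false Q p) (P q) (Q q)
     (r0 p) (r1 p) (l `^ m) => ? ? ? ? ? ? ? ? ? ? ? ? ? E.
  by lra.
have n1 : m + 1 != 0 by have := mk (ltn0Sn _ : (1 <= k.+1)%N); rewrite mul1r.
have n2 : 2%:R * m + 1 != 0 by apply: mk; lia.
have n3 : (k%:R + 1) * m + 1 != 0 by rewrite natr1; apply: mk.
(* [c1] and [c2] are the coefficients of the powers with exponents [m + 1] and [2 m + 1]; their
   denominators come from [Fcurve]. *)
pose c1 := (H p + k.-1%:R * D true P p + D false Q p) / (m + 1)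
           - (H p + k%:R * D true P p).
pose c2 := (k.-1%:R / (2%:R * m + 1) - k%:R / (m + 1)) * D true Q p.
have := @powR_lin_indep R [:: (r1 p, 0); (D false P p, 1); (c1, m + 1);
   (c2, 2%:R * m + 1); (- r0 p, m)].
move=> /=; rewrite !inE !negb_or => L.
have ne (x y : R) : (x = y -> [\/ m = 0, m = 1, m + 1 = 0 | 2%:R * m + 1 = 0]) -> x != y.
  by move=> h; apply/eqP => /h [] /eqP; exact/negP.
have {L} : [&& r1 p == 0, D false P p == 0, c1 == 0, c2 == 0, - r0 p == 0 & true].
  apply: L.
    do ?[apply/andP; split] => //; apply: ne => h;
      by [constructor 1; lra|constructor 2; lra|constructor 3; lra|constructor 4; lra].
  move=> l l0; rewrite !big_cons big_nil addr0 /= powRr0 powRr1 ?ltW//.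
  have ln0 : l != 0 by rewrite gt_eqF.
  have := E l l0; rewrite /Fcurve mul1r.
  have -> : 2%:R * m + 1 = m + m + 1 by ring.
  rewrite !powRD ?ln0 ?implybT// powRr1 ?ltW// => /eqP.
  rewrite -subr_eq0 => /eqP <-; rewrite /c1 /c2.
  have -> : 2%:R * m + 1 = m + m + 1 by ring.
  ring.
have kk : k%:R = k.-1%:R + 1 :> R by rewrite natr1 prednK//; lia.
move=> /and5P[_ /eqP YP /eqP C1 C2 /andP[]]; rewrite oppr_eq0 => /eqP R0 _.
split => //.
  (* If the numerical factor of [c2] vanished, then (k - 1)(m + 1) = k (2m + 1), that is (k + 1) m +
     1 = 0, which [mk] excludes at index [k + 1]. *)
  move: C2; rewrite /c2 mulf_eq0 => /orP[|/eqP //]; rewrite subr_eq0.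
  rewrite (can2_eq (divfK _) (mulfK _)) ?n2// => /eqP h.
  move: n3; rewrite (_ : _ + 1 = 0) ?eqxx//.
  have : k.-1%:R * (m + 1) = k%:R * (2%:R * m + 1) :> R.
    by rewrite h; field.
  by rewrite kk; lra.
move: C1; rewrite /c1 => /eqP; rewrite subr_eq0 (can2_eq (divfK _) (mulfK _)) ?n1//.
by move=> /eqP; rewrite kk; lra.
Qed.

End Tangency.

(** * The symmetries of the list *)

Section Linearity.
Variable R : realType.
Implicit Types (f : J1 R -> R) (g h : jfun R) (p : jpt R).

Lemma iter_jD_add M n d i g h : (0 < n)%N -> (n + i <= M.+1)%N ->
  ord n g -> ord n h ->
  iter i (jD M d) (fun p => g p + h p) =
  (fun p => iter i (jD M d) g p + iter i (jD M d) h p).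
Proof.
move=> n0 + Og Oh; elim: i => // i IH niM; rewrite !iterS IH; last by lia.
by apply: jD_add; apply: (@ord_jderivable _ (n + i)); apply: ord_iter => //; lia.
Qed.

Lemma iter_jD_scale M n d i (c : R) g : (0 < n)%N -> (n + i <= M.+1)%N ->
  ord n g -> iter i (jD M d) (fun p => c * g p) = (fun p => c * iter i (jD M d) g p).
Proof.
move=> n0 + Og; elim: i => // i IH niM; rewrite !iterS IH; last by lia.
apply: tderE; apply: tder_scale; first by lia.
by apply: (@tder_ord _ _ (n + i)); apply: ord_iter => //; lia.
Qed.

Lemma prol_coefD f1 f2 i j p : smooth f1 -> smooth f2 ->
  prol_coef (fun v => f1 v + f2 v) i j p = prol_coef f1 i j p + prol_coef f2 i j p.
Proof.
move=> H1 H2; have H12 := smoothD H1 H2; pose M := (i + j).+1.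
have ijM : (i + j <= M)%N by rewrite /M.
have O f : smooth f -> ord 1 (lift1 f) by move=> Hf; exact: ord_lift1.
rewrite !(prol_coefE _ _ ijM)// !pdD//.
have Oy f : smooth f -> ord (1 + j) (iter j (jD M false) (lift1 f)).
  by move=> Hf; apply: ord_iter => //; [lia|exact: O].
rewrite [lift1 (fun v => f1 v + f2 v)](_ : _ = fun p => lift1 f1 p + lift1 f2 p)//.
rewrite (@iter_jD_add M 1 false)//; [|lia|exact: O|exact: O].
rewrite (@iter_jD_add M (1 + j) true)//; [|lia|exact: Oy|exact: Oy].
by rewrite /lift1; ring.
Qed.

Lemma prol_coefZ (c : R) f i j p : smooth f ->
  prol_coef (fun v => c * f v) i j p = c * prol_coef f i j p.
Proof.
move=> Hf; have Hc := smoothZ c Hf; pose M := (i + j).+1.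
have ijM : (i + j <= M)%N by rewrite /M.
rewrite !(prol_coefE _ _ ijM)// !pdZ//.
rewrite [lift1 (fun v => c * f v)](_ : _ = fun p => c * lift1 f p)//.
rewrite (@iter_jD_scale M 1 false)//; [|lia|exact: ord_lift1].
rewrite (@iter_jD_scale M (1 + j) true)//; [|lia|].
  by rewrite /lift1; ring.
by apply: ord_iter => //; [lia|exact: ord_lift1].
Qed.

Lemma contact_symmetryD m k f1 f2 : smooth f1 -> smooth f2 ->
  contact_symmetry m k f1 -> contact_symmetry m k f2 ->
  contact_symmetry m k (fun v => f1 v + f2 v).
Proof.
move=> H1 H2 S1 S2 l p Fp; have [c1 h1] := S1 l p Fp; have [c2 h2] := S2 l p Fp.
by exists (c1 + c2) => i ik; rewrite prol_coefD// h1// h2// mulrDl.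
Qed.

Lemma contact_symmetryZ m k (c : R) f : smooth f ->
  contact_symmetry m k f -> contact_symmetry m k (fun v => c * f v).
Proof.
move=> Hf S l p Fp; have [c1 h1] := S l p Fp.
by exists (c * c1) => i ik; rewrite prol_coefZ// h1// mulrA.
Qed.

End Linearity.

(** * Prolongations of u, u_x, u_y, x u_x and y u_y *)

Section BasicGenerators.
Variable R : realType.
Implicit Types (f : J1 R -> R) (g h : jfun R) (p : jpt R).

Lemma smooth_j1x : smooth (@j1x R). Proof. exact: smooth_coord. Qed.
Lemma smooth_j1y : smooth (@j1y R). Proof. exact: smooth_coord. Qed.
Lemma smooth_j1u : smooth (@j1u R). Proof. exact: smooth_coord. Qed.
Lemma smooth_j1ux : smooth (@j1ux R). Proof. exact: smooth_coord. Qed.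
Lemma smooth_j1uy : smooth (@j1uy R). Proof. exact: smooth_coord. Qed.

Lemma lift1_coord (p : jpt R) (i : nat) : (i < 5)%N ->
  proj1 p ord0 (inord i) = nth 0 [:: jx p; jy p; ju p 0 0; ju p 1 0; ju p 0 1] i.
Proof. by move=> i5; rewrite mxE inordK. Qed.

Lemma lift1_j1x : lift1 (@j1x R) = @jx R.
Proof. by apply/funext => p; rewrite /lift1 /j1x lift1_coord. Qed.
Lemma lift1_j1y : lift1 (@j1y R) = @jy R.
Proof. by apply/funext => p; rewrite /lift1 /j1y lift1_coord. Qed.
Lemma lift1_j1u : lift1 (@j1u R) = fun p => ju p 0 0.
Proof. by apply/funext => p; rewrite /lift1 /j1u lift1_coord. Qed.
Lemma lift1_j1ux : lift1 (@j1ux R) = fun p => ju p 1 0.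
Proof. by apply/funext => p; rewrite /lift1 /j1ux lift1_coord. Qed.
Lemma lift1_j1uy : lift1 (@j1uy R) = fun p => ju p 0 1.
Proof. by apply/funext => p; rewrite /lift1 /j1uy lift1_coord. Qed.

Lemma iter_jDy_ju M a b j : (a + b + j <= M.+1)%N ->
  iter j (jD M false) (fun p : jpt R => ju p a b) = (fun p => ju p a (b + j)).
Proof.
elim: j => [|j IH] abj; first by rewrite addn0.
by rewrite iterS IH ?jD_ju//; [apply/funext => p; rewrite addnS|lia|lia].
Qed.

Lemma iter_jDx_ju M a b i : (a + b + i <= M.+1)%N ->
  iter i (jD M true) (fun p : jpt R => ju p a b) = (fun p => ju p (a + i) b).
Proof.
elim: i => [|i IH] abi; first by rewrite addn0.
by rewrite iterS IH ?jD_ju//; [apply/funext => p; rewrite addnS|lia|lia].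
Qed.

Lemma tder_jx M d : (0 < M)%N -> tder M d (@jx R) (fun=> d%:R).
Proof.
move=> M0; rewrite -lift1_j1x; split; first exact: jderivable_lift1 smooth_j1x.
rewrite (jD_lift1 d smooth_j1x M0); apply/funext => p.
rewrite /j1x /lift1 !pd_coord//; last by case: d.
by case: d => /=; rewrite !mulr0 !addr0.
Qed.

Lemma tder_jy M d : (0 < M)%N -> tder M d (@jy R) (fun=> (~~ d)%:R).
Proof.
move=> M0; rewrite -lift1_j1y; split; first exact: jderivable_lift1 smooth_j1y.
rewrite (jD_lift1 d smooth_j1y M0); apply/funext => p.
rewrite /j1y /lift1 !pd_coord//; last by case: d.
by case: d => /=; rewrite !mulr0 !addr0.
Qed.

Lemma prol_coef_u i j p : prol_coef (@j1u R) i j p = ju p i j.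
Proof.
have ijM : (i + j <= (i + j).+1)%N by [].
rewrite (prol_coefE _ smooth_j1u ijM) lift1_j1u iter_jDy_ju ?iter_jDx_ju; try lia.
by rewrite /j1u /lift1 !pd_coord//= !mul0r !subr0.
Qed.

(** The field is a translation in x: the term u_{i+1,j} of the characteristic is cancelled by
    [cxi = -1]. *)
Lemma prol_coef_ux i j p : prol_coef (@j1ux R) i j p = 0.
Proof.
have ijM : (i + j <= (i + j).+1)%N by [].
rewrite (prol_coefE _ smooth_j1ux ijM) lift1_j1ux iter_jDy_ju ?iter_jDx_ju; try lia.
by rewrite /j1ux /lift1 !pd_coord//= !mul0r !subr0 mul1r add1n subrr.
Qed.

Lemma prol_coef_uy i j p : prol_coef (@j1uy R) i j p = 0.
Proof.
have ijM : (i + j <= (i + j).+1)%N by [].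
rewrite (prol_coefE _ smooth_j1uy ijM) lift1_j1uy iter_jDy_ju ?iter_jDx_ju; try lia.
by rewrite /j1uy /lift1 !pd_coord//= !mul0r !subr0 mul1r add1n subrr.
Qed.

(** As Yx = 0 and Xx = 1, the derivative of x u_x is x u_{i+1,j} + i u_{ij}, and the prolongation
    formula cancels the first term. *)
Lemma prol_coef_x_ux i j p :
  prol_coef (fun v : J1 R => j1x v * j1ux v) i j p = i%:R * ju p i j.
Proof.
pose M := (i + j).+1; have ijM : (i + j <= M)%N by rewrite /M.
have M0 : (0 < M)%N by [].
rewrite (prol_coefE _ (smoothM smooth_j1x smooth_j1ux) ijM).
have -> : lift1 (fun v : J1 R => j1x v * j1ux v) = fun p => jx p * ju p 1 0.
  by rewrite -lift1_j1x; apply/funext => q; rewrite -[ju q 1 0](congr1 (@^~ q) lift1_j1ux).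
have Ey n : (n <= j)%N -> iter n (jD M false) (fun p => jx p * ju p 1 0) =
    fun p => jx p * ju p 1 n.
  elim: n => [//|n IH nj]; rewrite iterS (IH (ltnW nj)); apply: tderE.
  have b : (1 + n <= M)%N by rewrite /M; lia.
  apply: tder_eq (tder_mul (tder_jx false M0) (tder_ju R false b)) _ => q.
  by rewrite mul0r addr0.
have Ex n : (n <= i)%N -> iter n (jD M true) (fun p => jx p * ju p 1 j) =
    fun p => jx p * ju p n.+1 j + n%:R * ju p n j.
  elim: n => [|n IH] ni; first by apply/funext => q; rewrite /= mul0r addr0.
  rewrite iterS (IH (ltnW ni)); apply: tderE.
  have b1 : (n.+1 + j <= M)%N by rewrite /M; lia.
  have b2 : (n + j <= M)%N by rewrite /M; lia.
  apply: tder_eq (tder_add (tder_mul (tder_jx true M0) (tder_jux R b1))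
    (tder_scale n%:R M0 (tder_jux R b2))) _ => q.
  by rewrite -natr1 /=; ring.
have -> : pd 3 (fun v : J1 R => j1x v * j1ux v) = @j1x R.
  rewrite (pdM 3 smooth_j1x smooth_j1ux) /j1x /j1ux !pd_coord//=.
  by apply/funext => v; rewrite mulr1 mulr0 addr0.
have -> : pd 4 (fun v : J1 R => j1x v * j1ux v) = cst 0.
  rewrite (pdM 4 smooth_j1x smooth_j1ux) /j1x /j1ux !pd_coord//=.
  by apply/funext => v; rewrite !mulr0 addr0.
rewrite Ey// Ex// lift1_j1x [lift1 (cst 0) p](_ : _ = 0)// mul0r.
ring.
Qed.

Lemma prol_coef_y_uy i j p :
  prol_coef (fun v : J1 R => j1y v * j1uy v) i j p = j%:R * ju p i j.
Proof.
pose M := (i + j).+1; have ijM : (i + j <= M)%N by rewrite /M.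
have M0 : (0 < M)%N by [].
rewrite (prol_coefE _ (smoothM smooth_j1y smooth_j1uy) ijM).
have -> : lift1 (fun v : J1 R => j1y v * j1uy v) = fun p => jy p * ju p 0 1.
  by rewrite -lift1_j1y; apply/funext => q; rewrite -[ju q 0 1](congr1 (@^~ q) lift1_j1uy).
have Ey n : (n <= j)%N -> iter n (jD M false) (fun p => jy p * ju p 0 1) =
    fun p => jy p * ju p 0 n.+1 + n%:R * ju p 0 n.
  elim: n => [|n IH] ni; first by apply/funext => q; rewrite /= mul0r addr0.
  rewrite iterS (IH (ltnW ni)); apply: tderE.
  have b1 : (0 + n.+1 <= M)%N by rewrite /M; lia.
  have b2 : (0 + n <= M)%N by rewrite /M; lia.
  apply: tder_eq (tder_add (tder_mul (tder_jy false M0) (tder_ju R false b1))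
    (tder_scale n%:R M0 (tder_ju R false b2))) _ => q.
  by rewrite -natr1 /= !add0n !add1n; ring.
have Ex n : (n <= i)%N ->
    iter n (jD M true) (fun p => jy p * ju p 0 j.+1 + j%:R * ju p 0 j) =
    fun p => jy p * ju p n j.+1 + j%:R * ju p n j.
  elim: n => [//|n IH ni]; rewrite iterS (IH (ltnW ni)); apply: tderE.
  have b1 : (n + j.+1 <= M)%N by rewrite /M; lia.
  have b2 : (n + j <= M)%N by rewrite /M; lia.
  apply: tder_eq (tder_add (tder_mul (tder_jy true M0) (tder_jux R b1))
    (tder_scale j%:R M0 (tder_jux R b2))) _ => q.
  by rewrite mul0r addr0.
have -> : pd 4 (fun v : J1 R => j1y v * j1uy v) = @j1y R.
  rewrite (pdM 4 smooth_j1y smooth_j1uy) /j1y /j1uy !pd_coord//=.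
  by apply/funext => v; rewrite mulr1 mulr0 addr0.
have -> : pd 3 (fun v : J1 R => j1y v * j1uy v) = cst 0.
  rewrite (pdM 3 smooth_j1y smooth_j1uy) /j1y /j1uy !pd_coord//=.
  by apply/funext => v; rewrite !mulr0 addr0.
rewrite Ey// Ex// lift1_j1y [lift1 (cst 0) p](_ : _ = 0)// mul0r.
ring.
Qed.

End BasicGenerators.

(** * Generating functions of x and y, and the two scalings *)

Section BaseFunctions.
Variable R : realType.
Implicit Types (f g : J1 R -> R) (p : jpt R).

(** Functions on the base, encoded by vanishing fibre derivatives; every [pd i] preserves this
    condition. *)
Definition xyfun g := smooth g /\ forall i, (1 < i < 5)%N -> pd i g = cst 0.

Lemma xyfun_pd i g : xyfun g -> xyfun (pd i g).
Proof.
move=> [Hg g0]; split; first exact: smooth_pd.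
by move=> j j5; rewrite pd_comm// g0// pd_cst.
Qed.

Lemma xyfun_iter_pd i n g : xyfun g -> xyfun (iter n (pd i) g).
Proof. by move=> Hg; elim: n => // n IH; rewrite iterS; exact: xyfun_pd. Qed.

Lemma jD_xyfun M d g : (0 < M)%N -> xyfun g -> jD M d (lift1 g) = lift1 (pd (~~ d) g).
Proof.
move=> M0 [Hg g0]; apply/funext => p; rewrite D_lift1//.
by rewrite (g0 2)// (g0 3)// (g0 4)// /lift1/= !mulr0 !addr0.
Qed.

Lemma iter_jD_xyfun M d n g : (0 < M)%N -> xyfun g ->
  iter n (jD M d) (lift1 g) = lift1 (iter n (pd (~~ d)) g).
Proof.
move=> M0 Hg; elim: n => [//|n IH]; rewrite !iterS IH jD_xyfun//.
exact: xyfun_iter_pd.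
Qed.

Lemma prol_coef_xyfun g i j p : xyfun g ->
  prol_coef g i j p = iter i (pd 0) (iter j (pd 1) g) (proj1 p).
Proof.
move=> Hg; have ijM : (i + j <= (i + j).+1)%N by [].
rewrite (prol_coefE _ Hg.1 ijM) iter_jD_xyfun// iter_jD_xyfun//; last exact: xyfun_iter_pd.
rewrite (Hg.2 3)// (Hg.2 4)// [lift1 (cst 0) p](_ : _ = 0)//.
by rewrite !mul0r !subr0.
Qed.

Lemma pdX i n f : smooth f ->
  pd i (fun v => f v ^+ n) = (fun v => n%:R * f v ^+ n.-1 * pd i f v).
Proof.
move=> Hf; elim: n => [|n IH].
  rewrite (_ : (fun v => _) = cst 1); last by apply/funext => v; rewrite expr0.
  by rewrite pd_cst; apply/funext => v; rewrite !mul0r.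
rewrite (_ : (fun v => _) = fun v => f v * f v ^+ n); last first.
  by apply/funext => v; rewrite exprS.
rewrite pdM//; last exact: smoothX.
rewrite IH; apply/funext => v; case: n {IH} => [|n] /=.
  by rewrite !mul0r mulr0 add0r expr0 !mul1r.
by rewrite exprS -[in RHS]natr1; ring.
Qed.

Definition xymono a b : J1 R -> R := fun v => j1x v ^+ a * j1y v ^+ b.

Lemma pd_xymono i a b : (i < 5)%N -> pd i (xymono a b) = fun v =>
  j1x v ^+ a * (b%:R * j1y v ^+ b.-1 * (i == 1%N)%:R)
  + j1y v ^+ b * (a%:R * j1x v ^+ a.-1 * (i == 0%N)%:R).
Proof.
move=> i5; have Hx := @smooth_j1x R; have Hy := @smooth_j1y R.
rewrite (pdM i (smoothX a Hx) (smoothX b Hy)) (pdX i a Hx) (pdX i b Hy).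
by rewrite /j1x /j1y !pd_coord.
Qed.

Lemma xyfun_xymono a b : xyfun (xymono a b).
Proof.
split; first by apply: smoothM; apply: smoothX; exact: smooth_coord.
move=> i i5; rewrite pd_xymono; last by lia.
have -> : (i == 1%N) = false by lia.
have -> : (i == 0%N) = false by lia.
by apply/funext => v; rewrite !mulr0 addr0.
Qed.

Lemma pd1_xymono (c : R) a b :
  pd 1 (fun v => c * xymono a b v) = fun v => (c * b%:R) * xymono a b.-1 v.
Proof.
rewrite pdZ; last exact: (xyfun_xymono a b).1.
by rewrite pd_xymono//=; apply/funext => v; rewrite /xymono mulr1 mulr0 mulr0 addr0; ring.
Qed.

Lemma pd0_xymono (c : R) a b :
  pd 0 (fun v => c * xymono a b v) = fun v => (c * a%:R) * xymono a.-1 b v.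
Proof.
rewrite pdZ; last exact: (xyfun_xymono a b).1.
by rewrite pd_xymono//=; apply/funext => v; rewrite /xymono mulr1 mulr0 mulr0 add0r; ring.
Qed.

Lemma iter_pd_xymono i j a b : iter i (pd 0) (iter j (pd 1) (xymono a b)) =
  fun v => (b ^_ j * a ^_ i)%:R * xymono (a - i) (b - j) v.
Proof.
have -> : iter j (pd 1) (xymono a b) = fun v => (b ^_ j)%:R * xymono a (b - j) v.
  elim: j => [|j IH]; first by apply/funext => v; rewrite /= ffactn0 mul1r subn0.
  by rewrite iterS IH pd1_xymono ffactnSr natrM subnS.
elim: i => [|i IH]; first by apply/funext => v; rewrite /= ffactn0 muln1 subn0.
by rewrite iterS IH pd0_xymono ffactnSr mulnA [in RHS]natrM subnS.
Qed.

(** Since [a + b < k], either [b < i] or [a < k - i], so one of the two falling factorials is 0. *)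
Lemma contact_symmetry_xymono m k a b : (a + b < k)%N ->
  contact_symmetry m k (xymono a b).
Proof.
move=> abk l p _; exists 0 => i ik; rewrite mul0r.
rewrite (prol_coef_xyfun _ _ _ (xyfun_xymono a b)) iter_pd_xymono.
have [bi|ib] := ltnP b i; first by rewrite ffact_small// mul0n mul0r.
by rewrite [X in (_ * X)%N]ffact_small ?muln0 ?mul0r//; lia.
Qed.

Definition scal1 m k : J1 R -> R := fun v => (k%:R * m + 1) * j1u v - m * j1x v * j1ux v.
Definition scal2 m : J1 R -> R := fun v => j1u v + m * j1y v * j1uy v.

Lemma scal1E m k : scal1 m k =
  fun v => (k%:R * m + 1) * j1u v + (- m) * (j1x v * j1ux v).
Proof. by apply/funext => v; rewrite /scal1 mulNr mulrA. Qed.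

Lemma scal2E m : scal2 m = fun v => j1u v + m * (j1y v * j1uy v).
Proof. by apply/funext => v; rewrite /scal2 mulrA. Qed.

Lemma smooth_scal1 m k : smooth (scal1 m k).
Proof.
rewrite scal1E; apply: smoothD; apply: smoothZ; first exact: smooth_coord.
by apply: smoothM; exact: smooth_coord.
Qed.

Lemma smooth_scal2 m : smooth (scal2 m).
Proof.
rewrite scal2E; apply: smoothD; first exact: smooth_coord.
by apply: smoothZ; apply: smoothM; exact: smooth_coord.
Qed.

Lemma prol_coef_scal1 m k i j p :
  prol_coef (scal1 m k) i j p = (k%:R * m + 1 - m * i%:R) * ju p i j.
Proof.
have Hx := smoothM (@smooth_j1x R) (@smooth_j1ux R).
rewrite scal1E (prol_coefD _ _ _ (smoothZ _ (@smooth_j1u R)) (smoothZ _ Hx)).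
rewrite (prol_coefZ _ _ _ _ (@smooth_j1u R)) (prol_coefZ _ _ _ _ Hx).
by rewrite prol_coef_u prol_coef_x_ux; ring.
Qed.

Lemma prol_coef_scal2 m i j p :
  prol_coef (scal2 m) i j p = (1 + m * j%:R) * ju p i j.
Proof.
have Hy := smoothM (@smooth_j1y R) (@smooth_j1uy R).
rewrite scal2E (prol_coefD _ _ _ (@smooth_j1u R) (smoothZ _ Hy)).
rewrite (prol_coefZ _ _ _ _ Hy) prol_coef_u prol_coef_y_uy; ring.
Qed.

(** On F_k the product (im + 1) u_{k-i,i} is [l] times the [i]-th component of the tangent of the
    curve. Both scalings act on the jets of order [k] in this way. *)
Lemma contact_symmetry_scal (m : R) k g :
  (forall i, (i <= k)%N -> i%:R * m + 1 != 0) ->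
  (forall i p, (i <= k)%N -> prol_coef g (k - i) i p = (i%:R * m + 1) * ju p (k - i) i) ->
  contact_symmetry m k g.
Proof.
move=> mk Hg l p [l0 Fp]; exists l => i ik.
rewrite derive1_Fcurve ?mk// Hg// Fp// /Fcurve mulrCA divff ?mk// mulr1.
have ln0 : l != 0 by rewrite gt_eqF.
by rewrite powRD ?ln0 ?implybT// powRr1 ?ltW// mulrC.
Qed.

Lemma contact_symmetry_scal1 (m : R) k :
  (forall i, (i <= k)%N -> i%:R * m + 1 != 0) -> contact_symmetry m k (scal1 m k).
Proof.
move=> mk; apply: contact_symmetry_scal => // i p ik.
by rewrite prol_coef_scal1 natrB//; congr (_ * _); ring.
Qed.

Lemma contact_symmetry_scal2 (m : R) k :
  (forall i, (i <= k)%N -> i%:R * m + 1 != 0) -> contact_symmetry m k (scal2 m).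
Proof.
move=> mk; apply: contact_symmetry_scal => // i p ik.
by rewrite prol_coef_scal2; congr (_ * _); ring.
Qed.

Lemma contact_symmetry_ux m k : contact_symmetry m k (@j1ux R).
Proof. by move=> l p _; exists 0 => i ik; rewrite prol_coef_ux mul0r. Qed.

Lemma contact_symmetry_uy m k : contact_symmetry m k (@j1uy R).
Proof. by move=> l p _; exists 0 => i ik; rewrite prol_coef_uy mul0r. Qed.

(** A jet over [v] with prescribed u_20, u_11 and u_02. *)
Definition jof (v : J1 R) (a b c : R) : jpt R := JPt (j1x v) (j1y v)
  (fun i j => match i, j with
    | 0, 0 => j1u v | 1, 0 => j1ux v | 0, 1 => j1uy v
    | 2, 0 => a | 1, 1 => b | 0, 2 => c | _, _ => 0 end).

Lemma proj1_jof v a b c : proj1 (jof v a b c) = v.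
Proof.
apply/rowP => i; rewrite mxE -[in RHS](inord_val i).
by case: i => [[|[|[|[|[|//]]]]] ?].
Qed.

(* As the coefficients of s and t vanish, pd i f and pd 2 f do not depend on the
   coordinate j of v, and the equation is affine in that coordinate. *)
Lemma fibre_coefficients i j f : smooth f -> (j < 5)%N ->
  (j == 3%N) || (j == 4%N) ->
  (forall v s t, pd i f v + v ord0 (inord j) * pd 2 f v + s * pd 3 f v
     + t * pd 4 f v = 0) ->
  [/\ pd i f = cst 0, pd 2 f = cst 0, pd 3 f = cst 0 & pd 4 f = cst 0].
Proof.
move=> Hf j5 j34 E.
have E00 v : pd i f v + v ord0 (inord j) * pd 2 f v = 0.
  by rewrite -[RHS](E v 0 0) !mul0r !addr0.
have f3 : pd 3 f = cst 0.
  by apply/funext => v; have := E v 1 0; rewrite E00 mul0r mul1r add0r addr0.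
have f4 : pd 4 f = cst 0.
  by apply/funext => v; have := E v 0 1; rewrite E00 mul0r mul1r !add0r.
have fj : pd j f = cst 0 by case/orP: j34 => /eqP ->.
have inv n v : pd n f (v + 1 *: delta_mx ord0 (inord j)) = pd n f v.
  by apply: pd0_line => [|w]; [exact: smooth_pd|rewrite pd_comm// fj pd_cst].
have f2 : pd 2 f = cst 0.
  apply/funext => v; have := E00 (v + 1 *: delta_mx ord0 (inord j)).
  rewrite !inv !mxE !eqxx /= mulr1 mulrDl addrA E00 add0r mul1r.
  by [].
split=> //; apply/funext => v; have := E00 v; rewrite f2 /= mulr0 addr0.
by [].
Qed.

End BaseFunctions.

(** * Structure of the generating functions *)

Section Structure.
Variables (R : realType) (k : nat) (m : R).
Hypothesis k2 : (2 < k)%N.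
Hypothesis m0 : m != 0.
Hypothesis m1 : m != 1.
Hypothesis mk : forall i, (i <= k.+1)%N -> i%:R * m + 1 != 0.
Variable f : J1 R -> R.
Hypothesis Hf : smooth f.
Hypothesis Sf : contact_symmetry m k f.

Local Notation M := (k + 3)%N.
Local Notation D := (jD M).
Local Notation P := (pd 3 f).
Local Notation Q := (pd 4 f).
Local Notation H := (pd 2 f).

Let HP := smooth_pd 3 Hf.
Let HQ := smooth_pd 4 Hf.
Let HH := smooth_pd 2 Hf.

Let M0 : (0 < M)%N. Proof. by lia. Qed.

(** In YP = 0 the coordinates u_11 and u_02 are free, so [fibre_coefficients] applies; [coeffs_Q] is
    the mirror image. *)
Lemma coeffs_P i : (0 < i < 5)%N -> pd i P = cst 0.
Proof.
have [r _ [_ _ YP _ _]] := determining_equations k2 m0 m1 mk Hf Sf.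
have [//|//||p1 p2 p3 p4] := @fibre_coefficients R 1 4 P HP.
  move=> v s t; have := YP (jof v 0 s t).
  by rewrite (D_lift1 _ _ HP M0) /lift1 proj1_jof.
by case: i => [|[|[|[|[|]]]]].
Qed.

Lemma coeffs_Q i : (i != 1)%N -> (i < 5)%N -> pd i Q = cst 0.
Proof.
have [r _ [_ _ _ XQ _]] := determining_equations k2 m0 m1 mk Hf Sf.
have [//|//||q1 q2 q3 q4] := @fibre_coefficients R 0 3 Q HQ.
  move=> v s t; have := XQ (jof v s t 0).
  by rewrite (D_lift1 _ _ HQ M0) /lift1 proj1_jof.
by case: i => [|[|[|[|[|]]]]].
Qed.

Let DP : D true (lift1 P) = lift1 (pd 0 P).
Proof.
apply/funext => p; rewrite (D_lift1 _ _ HP M0) (coeffs_P (i := 2))//.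
by rewrite (coeffs_P (i := 3))// (coeffs_P (i := 4))// /lift1/= !mulr0 !addr0.
Qed.

Let DQ : D false (lift1 Q) = lift1 (pd 1 Q).
Proof.
apply/funext => p; rewrite (D_lift1 _ _ HQ M0) (coeffs_Q (i := 2))//.
by rewrite (coeffs_Q (i := 3))// (coeffs_Q (i := 4))// /lift1/= !mulr0 !addr0.
Qed.

Lemma scaling_relation :
  H = fun v => m^-1 * (pd 1 Q v + - (1 + k%:R * m) * pd 0 P v).
Proof.
have [r _ [_ _ _ _ E]] := determining_equations k2 m0 m1 mk Hf Sf.
apply/funext => v; have := E (jof v 0 0 0).
rewrite DP DQ /lift1 proj1_jof => E'.
apply: (mulfI m0); rewrite mulrA divff// mul1r.
move: (pd 1 Q v) (pd 0 P v) (H v) E' => a b c E'; lra.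
Qed.

Let pdH i : pd i H =
  fun v => m^-1 * (pd i (pd 1 Q) v + - (1 + k%:R * m) * pd i (pd 0 P) v).
Proof.
have H1 := smooth_pd 1 HQ; have H0 := smooth_pd 0 HP.
rewrite {1}scaling_relation pdZ; last by apply: smoothD => //; exact: smoothZ.
by rewrite pdD//; [rewrite pdZ|exact: smoothZ].
Qed.

Let pdP i : (0 < i < 5)%N -> pd i (pd 0 P) = cst 0.
Proof. by move=> i5; rewrite pd_comm// coeffs_P// pd_cst. Qed.

Let pdQ i : (i != 1)%N -> (i < 5)%N -> pd i (pd 1 Q) = cst 0.
Proof. by move=> i1 i5; rewrite pd_comm// coeffs_Q// pd_cst. Qed.

Lemma coeffs_H i : (1 < i < 5)%N -> pd i H = cst 0.
Proof.
move=> i5; rewrite pdH pdP; last by lia.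
rewrite pdQ; try lia.
by apply/funext => v; rewrite /= mulr0 addr0 mulr0.
Qed.

(** What matters is that the right-hand side reads only the 1-jet and [l]: no jet of order 2 to
    [k - 1] can affect the component. *)
Lemma prol_coef_on_Fk l p i : inFk m k l p -> (i <= k)%N ->
  prol_coef f (k - i) i p =
  (lift1 H p + k%:R * lift1 (pd 0 P) p) * l * l `^ (i%:R * m).
Proof.
move=> Fp ik; rewrite (tangency k2 m0 m1 mk Sf Fp ik); congr (_ * _).
have [r _ [e r0 _ XQ _]] := determining_equations k2 m0 m1 mk Hf Sf.
rewrite (prol_coefE (M := M))//; last by lia.
rewrite /= e r0 /topform XQ DP /= -(Fcurve0 m Fp.1) -(Fp.2 0%N)// subn0.
move: (lift1 P p) (lift1 Q p) (lift1 H p) (lift1 _ p) (D _ _ p) (D _ _ p).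
move: (ju p k.+1 0) (ju p k 1) (ju p k 0) (ju p k.-1 1).
by move=> ? ? ? ? ? ? ? ? ? ?; ring.
Qed.

(* Compare two points of F_k which differ only in a pure derivative of order
   k - 1: prol_coef_on_Fk gives them the same component. *)
Lemma coeffs_H_base (d : bool) : pd d H = cst 0.
Proof.
apply/funext => v; pose n := k.-1.
have [||r Or e] := mixed_expand Hf coeffs_P coeffs_Q coeffs_H d (n := n) (M := M).
- by rewrite /n; lia.
- by rewrite /n; lia.
(* The component whose multi-index is [n] in direction [d] and 1 in the other one. *)
pose i := if d then 1%N else n.
have ik : (i <= k)%N by rewrite /i /n; case: (d); lia.
have e' : iter (k - i) (D true) (iter i (D false) (lift1 f)) =
    D (~~ d) (iter n (D d) (lift1 f)).
  rewrite /i; case: (d); last first.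
    by rewrite (_ : (k - n = 1)%N)// /n; lia.
  rewrite (_ : (k - 1 = n)%N); last by rewrite /n; lia.
  have: (n < k)%N by rewrite /n; lia.
  elim: (n) => // j IH jk; rewrite !iterS IH; last by lia.
  have O1 : ord 1 (lift1 f) by exact: ord_lift1.
  apply: (@D_comm _ _ (1 + j)); first by lia.
  by apply: ord_iter => //; lia.
(* A point of F_k over [v] with [l = 1], whose pure derivative of order [n] in direction [d] is
   [s]. *)
pose bump (s : R) : jpt R := JPt (j1x v) (j1y v) (fun a b =>
  if (a + b == k)%N then Fcurve m b 1
  else if (a == d * n)%N && (b == ~~ d * n)%N then s
  else ju (jof v 0 0 0) a b).
have Fb s : inFk m k 1 (bump s).
  by split=> // j jk /=; rewrite subnK// eqxx.
have pb s : proj1 (bump s) = v.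
  rewrite -[RHS](proj1_jof v 0 0 0); apply: (@proj1_jagree R 1) => //.
  split=> // a b ab /=.
  have -> : (a + b == k)%N = false by lia.
  have -> // : (a == d * n)%N && (b == ~~ d * n)%N = false.
  apply/negP => /andP[/eqP ea /eqP eb]; move: ab; rewrite ea eb /n.
  by case: (d) => /=; lia.
have same a b : (k <= a + b)%N -> ju (bump 1) a b = ju (bump 0) a b.
  move=> ab /=; case: ifP => // /negbT abk.
  have -> // : (a == d * n)%N && (b == ~~ d * n)%N = false.
  apply/negP => /andP[/eqP ea /eqP eb]; move: ab; rewrite ea eb /n.
  by case: (d) => /=; lia.
(* [r] has order [n - 1], so the jets of order [n] in its derivative carry an index in the other
   direction and are not the bumped one. *)
have same_r : D (~~ d) r (bump 1) = D (~~ d) r (bump 0).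
  apply: (jD_indep _ Or) => //; first by rewrite /n; lia.
  move=> a b ab /=; case: ifP => // _.
  have -> // : (a == d * n)%N && (b == ~~ d * n)%N = false.
  apply/negP => /andP[/eqP ea /eqP eb]; move: ab; rewrite ea eb /n.
  by case: (d) => /=; lia.
have bump_n s : ju (bump s) (d * n) (~~ d * n) = s.
  rewrite /= !eqxx /=.
  by have -> : (d * n + ~~ d * n == k)%N = false by rewrite /n; case: (d) => /=; lia.
have : prol_coef f (k - i) i (bump 1) = prol_coef f (k - i) i (bump 0).
  by rewrite !(prol_coef_on_Fk (Fb _) ik) /lift1 !pb.
rewrite !(prol_coefE (M := M))//; try lia.
rewrite e' e same_r !bump_n.
rewrite !same; [|by rewrite /i /n; case: (d) => /=; lia..].
rewrite /lift1 !pb mulr1 mulr0 addr0 => E.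
move: E; set X := D (~~ d) r (bump 0).
move: (pd d H v) X; rewrite /= => x X E.
by move: E; lra.
Qed.

Lemma structure : exists a b c e (g : J1 R -> R), xyfun g /\
  f = fun v => g v + (a * j1ux v + (b * j1uy v + (c * scal1 m k v + e * scal2 m v))).
Proof.
have km : 1 + k%:R * m != 0 by rewrite addrC mk.
(* Differentiating [scaling_relation] in x, where Q contributes nothing, turns H_x = 0 into P_xx =
   0, as 1 + km is nonzero. Likewise H_y = 0 gives Q_yy = 0. *)
have P00 : pd 0 (pd 0 P) = cst 0.
  apply/funext => v; have := congr1 (@^~ v) (coeffs_H_base false).
  rewrite /= pdH pdQ//= add0r => /eqP; rewrite mulf_eq0 invr_eq0 (negbTE m0) /=.
  by rewrite mulf_eq0 oppr_eq0 (negbTE km) => /eqP.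
have Q11 : pd 1 (pd 1 Q) = cst 0.
  apply/funext => v; have := congr1 (@^~ v) (coeffs_H_base true).
  rewrite /= pdH pdP//= mulr0 addr0 => /eqP; rewrite mulf_eq0 invr_eq0 (negbTE m0) /=.
  by move/eqP.
pose a1 := pd 0 P 0; pose b1 := pd 1 Q 0.
have P0c v : pd 0 P v = a1.
  apply: pd0_cst => [|i i5 w]; first exact: smooth_pd.
  by case: i i5 => [|i] i5; [rewrite P00|rewrite pdP].
have Q1c v : pd 1 Q v = b1.
  apply: pd0_cst => [|i i5 w]; first exact: smooth_pd.
  by have [->|i1] := eqVneq i 1%N; [rewrite Q11|rewrite pdQ].
have Hc v : H v = m^-1 * (b1 + - (1 + k%:R * m) * a1).
  by rewrite scaling_relation P0c Q1c.
(* Subtracting the linear function with slope [c] leaves a function with zero gradient. *)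
have aff G i (c : R) : smooth G -> (i < 5)%N -> (forall v, pd i G v = c) ->
    (forall j, (j < 5)%N -> j != i -> pd j G = cst 0) ->
    forall v, G v = G 0 + c * v ord0 (inord i).
  move=> HG i5 Gi Gj v; have Hi := @smooth_coord R (inord i).
  have E := @pd0_cst R (fun v => G v + (- c) * v ord0 (inord i)) v.
  have := E (smoothD HG (smoothZ _ Hi)); rewrite mxE mulr0 addr0 => <-; first by ring.
  move=> j j5 w; rewrite pdD//; last exact: smoothZ.
  rewrite pdZ// pd_coord//=.
  by have [->|ji] := eqVneq j i; [rewrite Gi mulr1 subrr|rewrite Gj//= mulr0 addr0].
have HPv v : P v = P 0 + a1 * j1x v.
  by apply: aff => // j j5 j0; rewrite coeffs_P// lt0n j0.
have HQv v : Q v = Q 0 + b1 * j1y v by apply: aff => // j j5 j0; rewrite coeffs_Q.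
(* [scal1] contributes -m x to P and [scal2] contributes m y to Q, which fixes [c] and [e]; the
   coefficient of u then agrees with [Hc]. *)
pose c := - (a1 / m); pose e := b1 / m.
pose rest v := P 0 * j1ux v + (Q 0 * j1uy v + (c * scal1 m k v + e * scal2 m v)).
have su := @smooth_j1u R; have sx := @smooth_j1x R; have sy := @smooth_j1y R.
have sux := @smooth_j1ux R; have suy := @smooth_j1uy R.
have restE : rest = fun v => (P 0 * j1ux v + Q 0 * j1uy v) +
    (a1 * (j1x v * j1ux v) + (b1 * (j1y v * j1uy v) +
      m^-1 * (b1 + - (1 + k%:R * m) * a1) * j1u v)).
  apply/funext => v; rewrite /rest /scal1 /scal2 /c /e.
  by field.
have srest : smooth rest.
  by rewrite restE; do ?[apply: smoothD|apply: smoothZ|apply: smoothM].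
have Hg := smoothD Hf (smoothZ (-1) srest).
exists (P 0), (Q 0), c, e, (fun v => f v + (-1) * rest v); split; last first.
  by apply/funext => v; rewrite -/(rest v); ring.
split=> // i i5; rewrite pdD//; last exact: smoothZ.
rewrite pdZ// restE.
rewrite !(pdZ, pdD, pdM); do ?[apply: smoothD|apply: smoothZ|apply: smoothM] => //.
have pdc j : (j < 5)%N -> pd i (fun v : J1 R => v ord0 (inord j)) = cst (i == j)%:R.
  by move=> j5; apply: pd_coord => //; lia.
rewrite /j1x /j1y /j1u /j1ux /j1uy !pdc// -/(j1x _).
apply/funext => v; case: i i5 {pdc} => [|[|[|[|[|]]]]] //= _.
- by rewrite Hc; ring.
- by rewrite HPv /j1x; ring.
- by rewrite HQv /j1y; ring.
Qed.

End Structure.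

(** * Taylor's formula and the basis *)

Section Taylor.
Variable R : realType.

(** [phi i] is the [i]-th derivative. By the induction hypothesis for the shifted sequence, [phi 0]
    and the polynomial have the same derivative, and they agree at 0. *)
Lemma taylor_poly n (phi : nat -> R -> R) :
  (forall i (x : R), is_derive x (1 : R) (phi i) (phi i.+1 x)) ->
  (forall x, phi n x = 0) ->
  forall x, phi 0%N x = (\poly_(i < n) (phi i 0 / i`!%:R)).[x].
Proof.
elim: n phi => [|n IH] phi dphi phin x; first by rewrite phin poly_def big_ord0 horner0.
set p := \poly_(i < n.+1) _.
have dp : p^`() = \poly_(i < n) (phi i.+1 0 / i`!%:R).
  apply/polyP => i; rewrite coef_deriv !coef_poly ltnS.
  case: ifP => _; last by rewrite mul0rn.
  have i0 : i.+1%:R != 0 :> R by rewrite pnatr_eq0.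
  have f0 : i`!%:R != 0 :> R by rewrite pnatr_eq0 -lt0n fact_gt0.
  rewrite factS natrM -mulr_natr; field.
  by rewrite f0 addrC natr1.
have d y : is_derive y (1 : R) (fun y => phi 0%N y - p.[y]) 0.
  have -> : 0 = phi 1%N y - p^`().[y].
    rewrite dp -(IH (fun i => phi i.+1)) ?subrr// => i z; exact: dphi.
  by apply: is_deriveB; exact: is_derive_poly.
have /= := @is_derive_0_is_cst R _ x 0 d.
rewrite [p.[0]]horner_coef0 coef_poly /= fact0 divr1 subrr => /eqP.
by rewrite subr_eq0 => /eqP.
Qed.

(** A nonzero [p] would have the roots 0, ..., [size p - 1], which are too many. *)
Lemma horner_eq0 (p : {poly R}) : (forall x, p.[x] = 0) -> p = 0.
Proof.
move=> p0; apply/eqP/negPn/negP => pn0.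
have u : uniq [seq (i%:R : R) | i <- iota 0 (size p)].
  rewrite map_inj_uniq ?iota_uniq// => i j /eqP; rewrite eqr_nat => /eqP //.
have := max_poly_roots pn0 _ u; rewrite size_map size_iota ltnn => h.
by apply: Bool.diff_false_true; apply: h; apply/allP => x _; apply/eqP.
Qed.

Definition basept (x y : R) : J1 R :=
  x *: delta_mx ord0 (inord 0) + y *: delta_mx ord0 (inord 1).

Lemma basept_coord x y i : (i < 5)%N ->
  basept x y ord0 (inord i) = x * (i == 0%N)%:R + y * (i == 1%N)%:R.
Proof. by move=> i5; rewrite !mxE !eqxx /= -!val_eqE /= !inordK. Qed.

Lemma xyfun_basept (g : J1 R -> R) v : xyfun g -> g v = g (basept (j1x v) (j1y v)).
Proof.
move=> [Hg g0].
have z i w : i \in [:: inord 2; inord 3; inord 4 : 'I_5] -> pd i g w = 0.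
  by rewrite !inE => /or3P[] /eqP ->; rewrite inordK// g0.
rewrite (pd0_reset v Hg (fun i ii w => z i w ii)); congr g.
apply/rowP => i; rewrite mxE -[in RHS](inord_val i) basept_coord// !inE.
rewrite -!val_eqE /= !inordK// /j1x /j1y.
case: i => [[|[|[|[|[|//]]]]] i5] /=; rewrite ?mulr1 ?mulr0 ?addr0 ?add0r//.
  by congr (v _ _); apply/val_inj; rewrite /= inordK.
by congr (v _ _); apply/val_inj; rewrite /= inordK.
Qed.

Lemma pd_line (g : J1 R -> R) i w (t : R) : smooth g ->
  is_derive t (1 : R) (fun s : R => g (w + s *: delta_mx ord0 (inord i)))
    (pd i g (w + t *: delta_mx ord0 (inord i))).
Proof.
by rewrite pd.unlock => Hg; apply: is_derive_line; exact: smooth_derivable.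
Qed.

(** Expansion in y up to order [k], then of the [j]-th coefficient in x up to order [k - j]; both
    stop there because derivatives of total order [k] vanish. *)
Lemma xyfun_taylor (g : J1 R -> R) k : xyfun g ->
  (forall i j, (i + j = k)%N -> forall v, iter i (pd 0) (iter j (pd 1) g) v = 0) ->
  forall v, g v = \sum_(j < k) \sum_(i < k - j)
     (iter i (pd 0) (iter j (pd 1) g) 0 / i`!%:R / j`!%:R) * xymono i j v.
Proof.
move=> Hg gk v; rewrite (xyfun_basept v Hg).
set x := j1x v; set y := j1y v.
pose e0 : J1 R := delta_mx ord0 (inord 0); pose e1 : J1 R := delta_mx ord0 (inord 1).
pose phi j (s : R) := iter j (pd 1) g (x *: e0 + s *: e1).
have dphi j (s : R) : is_derive s (1 : R) (phi j) (phi j.+1 s).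
  by apply: pd_line; have [] := xyfun_iter_pd 1 j Hg.
have -> : g (basept x y) = phi 0%N y by [].
rewrite (@taylor_poly k phi dphi) => [|s]; last exact: (gk 0%N k).
rewrite horner_poly; apply: eq_bigr => j _.
pose psi i (s : R) := iter i (pd 0) (iter j (pd 1) g) (0 + s *: e0).
have dpsi i (s : R) : is_derive s (1 : R) (psi i) (psi i.+1 s).
  by apply: pd_line; have [] := xyfun_iter_pd 0 i (xyfun_iter_pd 1 j Hg).
have -> : phi j 0 = psi 0%N x by rewrite /phi /psi /= scale0r addr0 add0r.
rewrite (@taylor_poly (k - j) psi dpsi) => [|s].
  rewrite horner_poly !mulr_suml; apply: eq_bigr => i _.
  rewrite /psi scale0r addr0 /xymono -/x -/y.
  move: (iter _ _ _ _) (x ^+ i) (y ^+ j) => a b c; ring.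
by rewrite /psi gk// subnK// ltnW.
Qed.

End Taylor.

(** * Size, span and linear independence of the list *)

Section Basis.
Variables (R : realType) (m : R) (k : nat).
Local Notation B := (sym_basis m k).
Local Notation N := (size (monomial_idx k)).
Local Notation idx := (monomial_idx k).

Lemma mem_monomial_idx i j : ((i, j) \in idx) = (i + j < k)%N.
Proof.
apply/allpairsPdep/idP => [[a [b [ak bk [-> ->]]]]|ij].
  by move: ak bk; rewrite !mem_iota; lia.
by exists i, j; rewrite !mem_iota; split=> //; lia.
Qed.

Lemma monomial_idx_uniq : uniq idx.
Proof.
apply: allpairs_uniq_dep => [|i _|]; try exact: iota_uniq.
by move=> [a b] [c d] _ _ /= [-> ->].
Qed.

Lemma size_monomial_idx : N = (k * k.+1 %/ 2)%N.
Proof.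
rewrite size_allpairs_dep sumnE big_map.
have -> : (\sum_(j <- iota 0 k) size (iota 0 (k - j)) = \sum_(0 <= i < k.+1) i)%N.
  rewrite big_nat_recl// add0n -[X in iota 0 X]subn0 -/(index_iota 0 k) big_nat_rev.
  by rewrite big_nat [RHS]big_nat; apply: eq_bigr => i ik; rewrite size_iota; lia.
by rewrite triangular_sum bin2 /= divn2 mulnC.
Qed.

Lemma size_sym_basis : size B = (N + 4)%N.
Proof. by rewrite size_cat size_map. Qed.

Definition extra : seq (J1 R -> R) := [:: @j1ux R; @j1uy R; scal1 m k; scal2 m].

Lemma nth_sym_basis b : nth (fun _ => 0) B b =
  if (b < N)%N then xymono (nth (0, 0)%N idx b).1 (nth (0, 0)%N idx b).2
  else nth (fun _ => 0) extra (b - N).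
Proof.
rewrite nth_cat size_map; case: ifP => // bN.
by rewrite (nth_map (0, 0)%N).
Qed.

Lemma nth_sym_basis_extra t :
  nth (fun _ => 0) B (N + t) = nth (fun _ => 0) extra t.
Proof. by rewrite nth_sym_basis ltnNge leq_addr addKn. Qed.

Lemma sum_sym_basis (c : nat -> R) v :
  \sum_(b < size B) c b * nth (fun _ => 0) B b v =
  \sum_(b < N) c b * xymono (nth (0, 0)%N idx b).1 (nth (0, 0)%N idx b).2 v +
  (c N * j1ux v + (c (N + 1)%N * j1uy v + (c (N + 2)%N * scal1 m k v + c (N + 3)%N * scal2 m v))).
Proof.
rewrite size_sym_basis big_split_ord /=; congr (_ + _).
  by apply: eq_bigr => i _; rewrite nth_sym_basis ltn_ord.
rewrite !big_ord_recl big_ord0 addr0 /=.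
have E t : c (N + t)%N * nth (fun _ => 0) B (N + t) v =
    c (N + t)%N * nth (fun _ => 0) extra t v by rewrite nth_sym_basis_extra.
congr (_ + (_ + (_ + _)));
  [by apply: etrans (E 0%N) _; rewrite addn0|exact: (E 1%N)|exact: (E 2%N)|exact: (E 3%N)].
Qed.

(** Coefficients given by a function can be added and scaled without keeping track of sizes. *)
Lemma in_spanP f : in_span B f <-> exists c : nat -> R,
  forall v, f v = \sum_(b < size B) c b * nth (fun _ => 0) B b v.
Proof.
split=> [[c [_ Hc]]|[c Hc]]; first by exists (fun b => c`_b).
exists (mkseq c (size B)); rewrite size_mkseq; split=> // v.
by rewrite Hc; apply: eq_bigr => b _; rewrite nth_mkseq.
Qed.

Lemma in_spanD f g : in_span B f -> in_span B g -> in_span B (fun v => f v + g v).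
Proof.
move=> /in_spanP[c Hc] /in_spanP[d Hd]; apply/in_spanP.
exists (fun b => c b + d b) => v; rewrite Hc Hd -big_split /=.
by apply: eq_bigr => b _; rewrite mulrDl.
Qed.

Lemma in_spanZ (a : R) f : in_span B f -> in_span B (fun v => a * f v).
Proof.
move=> /in_spanP[c Hc]; apply/in_spanP; exists (fun b => a * c b) => v.
by rewrite Hc mulr_sumr; apply: eq_bigr => b _; rewrite mulrA.
Qed.

Lemma in_span_nth b : (b < size B)%N -> in_span B (nth (fun _ => 0) B b).
Proof.
move=> bB; apply/in_spanP; exists (fun i => (i == b)%:R) => v.
rewrite (bigD1 (Ordinal bB)) //= eqxx mul1r big1 ?addr0// => i ib.
have -> : (i == b :> nat) = false by apply/negbTE.
by rewrite mul0r.
Qed.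

Lemma in_span_extra t : (t < 4)%N -> in_span B (nth (fun _ => 0) extra t).
Proof.
move=> t4; rewrite -nth_sym_basis_extra; apply: in_span_nth.
by rewrite size_sym_basis ltn_add2l.
Qed.

Lemma in_span_xymono i j : (i + j < k)%N -> in_span B (xymono i j).
Proof.
rewrite -mem_monomial_idx => ij.
have := @in_span_nth (index (i, j) idx); rewrite nth_sym_basis index_mem ij.
rewrite nth_index//=; apply.
by rewrite size_sym_basis (leq_trans _ (leq_addr _ _))// index_mem.
Qed.

Lemma in_span_sum n (F : nat -> J1 R -> R) :
  (forall i, (i < n)%N -> in_span B (F i)) -> in_span B (fun v => \sum_(i < n) F i v).
Proof.
elim: n => [|n IH] HF.
  apply/in_spanP; exists (fun=> 0) => v; rewrite big_ord0 big1// => b _.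
  by rewrite mul0r.
rewrite (_ : (fun v => _) = fun v => \sum_(i < n) F i v + F n v); last first.
  by apply/funext => v; rewrite big_ord_recr.
by apply: in_spanD; [apply: IH => i ni; apply: HF; exact: ltnW|exact: HF].
Qed.

(** At fixed y the sum is a polynomial in x that vanishes everywhere, so its coefficients vanish;
    these are polynomials in y, treated alike. Distinct index pairs then isolate each [c b]. *)
Lemma xymono_family_free (c : nat -> R) :
  (forall v : J1 R, \sum_(b < N) c b * xymono (nth (0, 0)%N idx b).1 (nth (0, 0)%N idx b).2 v = 0) ->
  forall b, (b < N)%N -> c b = 0.
Proof.
move=> c0 b0 b0N; pose e b := nth (0, 0)%N idx b.
have E x y : \sum_(b < N) c b * (x ^+ (e b).1 * y ^+ (e b).2) = 0.
  rewrite -[RHS](c0 (basept x y)); apply: eq_bigr => b _; rewrite /xymono /j1x /j1y.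
  by rewrite !basept_coord//= !mulr1 !mulr0 addr0 add0r.
have Ex y i : \sum_(b < N) (c b * y ^+ (e b).2) * (i == (e b).1)%:R = 0.
  pose p : {poly R} := \sum_(b < N) (c b * y ^+ (e b).2) *: 'X^((e b).1).
  have p0 : p = 0.
    apply: horner_eq0 => x; rewrite -[RHS](E x y) horner_sum; apply: eq_bigr => b _.
    by rewrite hornerZ hornerXn; ring.
  have := congr1 (fun q : {poly R} => q`_i) p0; rewrite coef0 coef_sum => h.
  by rewrite -[RHS]h; apply: eq_bigr => b _; rewrite coefZ coefXn.
have Exy i j : \sum_(b < N) c b * (i == (e b).1)%:R * (j == (e b).2)%:R = 0.
  pose p : {poly R} := \sum_(b < N) (c b * (i == (e b).1)%:R) *: 'X^((e b).2).
  have p0 : p = 0.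
    apply: horner_eq0 => y; rewrite -[RHS](Ex y i) horner_sum; apply: eq_bigr => b _.
    by rewrite hornerZ hornerXn; ring.
  have := congr1 (fun q : {poly R} => q`_j) p0; rewrite coef0 coef_sum => h.
  by rewrite -[RHS]h; apply: eq_bigr => b _; rewrite coefZ coefXn.
rewrite -[RHS](Exy (e b0).1 (e b0).2) (bigD1 (Ordinal b0N))//= !eqxx !mulr1.
rewrite big1 ?addr0// => b bb0; rewrite -mulrA -natrM mulnb.
have -> : ((e b0).1 == (e b).1) && ((e b0).2 == (e b).2) = false.
  apply/negP => /andP[/eqP h1 /eqP h2]; move: bb0 => /negP; apply.
  rewrite -val_eqE /= -(nth_uniq (0, 0)%N (ltn_ord b) b0N monomial_idx_uniq).
  by rewrite -/(e b) -/(e b0) [e b]surjective_pairing [e b0]surjective_pairing h1 h2.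
by rewrite mulr0.
Qed.

(** Where u = u_x = u_y = 0 the four other generators vanish, which settles the monomials; these
    four are then separated by evaluation at points with u = 0. *)
Lemma sym_basis_free : m != 0 -> lin_indep B.
Proof.
move=> m0 c sc c0.
have E v := etrans (esym (sum_sym_basis (fun b => c`_b) v)) (c0 v).
pose vec (t : seq R) : J1 R := \row_(i < 5) t`_i.
have vecE t i : (i < 5)%N -> vec t ord0 (inord i) = t`_i.
  by move=> i5; rewrite mxE inordK.
have cmono : forall b, (b < N)%N -> c`_b = 0.
  apply: (xymono_family_free (c := fun b => c`_b)) => v.
  have xyE w : xymono w.1 w.2 v = xymono w.1 w.2 (basept (j1x v) (j1y v)).
    exact: xyfun_basept (xyfun_xymono _ _ _).
  under eq_bigr do rewrite xyE.
  rewrite -[RHS](E (basept (j1x v) (j1y v))) /scal1 /scal2.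
  rewrite /j1ux /j1uy /j1u !basept_coord//= !mulr0 !addr0 !mulr0 subr0 !addr0.
  by rewrite !mulr0 !addr0.
have E' v : c`_N * j1ux v + (c`_(N + 1) * j1uy v +
    (c`_(N + 2) * scal1 m k v + c`_(N + 3) * scal2 m v)) = 0.
  rewrite -[RHS](E v) big1 ?add0r// => b _.
  by rewrite cmono ?mul0r.
have E4 x y p q : c`_N * p + (c`_(N + 1) * q +
    (c`_(N + 2) * (- (m * x * p)) + c`_(N + 3) * (m * y * q))) = 0.
  rewrite -[RHS](E' (vec [:: x; y; 0; p; q])) /scal1 /scal2.
  by rewrite /j1ux /j1uy /j1u /j1x /j1y !vecE//= mulr0 !add0r.
have h0 : c`_N = 0 by have := E4 0 0 1 0; lra.
have h1 : c`_(N + 1) = 0 by have := E4 0 0 0 1; lra.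
have h2 : c`_(N + 2) = 0.
  by have := E4 1 0 1 0; rewrite h0 h1 => h; apply: (mulIf m0); lra.
have h3 : c`_(N + 3) = 0.
  by have := E4 0 1 0 1; rewrite h0 h1 => h; apply: (mulIf m0); lra.
move=> b bB; have [bN|Nb] := ltnP b N; first exact: cmono.
move: bB; rewrite size_sym_basis -(subnKC Nb) ltn_add2l.
by case: (b - N)%N => [|[|[|[|]]]]; rewrite ?addn0.
Qed.


End Basis.

(** * The span of the list and the symmetry algebra coincide *)

Lemma contact_symmetry_span (R : realType) (m : R) k f :
  (forall i, (i <= k)%N -> i%:R * m + 1 != 0) ->
  in_span (sym_basis m k) f -> contact_symmetry m k f.
Proof.
move=> mk /in_spanP[c Hc].
have -> : f = fun v => \sum_(b < size (sym_basis m k))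
    c b * nth (fun _ => 0) (sym_basis m k) b v by apply/funext.
have S b : (b < size (sym_basis m k))%N ->
    smooth (nth (fun _ => 0) (sym_basis m k) b) /\
    contact_symmetry m k (nth (fun _ => 0) (sym_basis m k) b).
  rewrite size_sym_basis nth_sym_basis => bB.
  case: ltnP => [bN|Nb].
    split; first exact: (xyfun_xymono _ _ _).1.
    apply: contact_symmetry_xymono; rewrite -mem_monomial_idx -surjective_pairing.
    exact: mem_nth.
  move: bB; rewrite -{1}(subnKC Nb) ltn_add2l.
  case: (b - _)%N => [|[|[|[|//]]]] _ /=; split.
  - exact: smooth_j1ux.
  - exact: contact_symmetry_ux.
  - exact: smooth_j1uy.
  - exact: contact_symmetry_uy.
  - exact: smooth_scal1.
  - exact: contact_symmetry_scal1.
  - exact: smooth_scal2.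
  - exact: contact_symmetry_scal2.
suff key n : (n <= size (sym_basis m k))%N ->
  smooth (fun v => \sum_(b < n) c b * nth (fun _ => 0) (sym_basis m k) b v) /\
  contact_symmetry m k (fun v => \sum_(b < n) c b * nth (fun _ => 0) (sym_basis m k) b v).
  by have [] := key _ (leqnn _).
elim: n => [|n IH] nB.
  (* The empty sum is written as a multiple of a known symmetry. *)
  rewrite (_ : (fun v => _) = fun v : J1 R => 0 * j1ux v); last first.
    by apply/funext => v; rewrite big_ord0 mul0r.
  split; first by apply: smoothZ; exact: smooth_j1ux.
  by apply: contact_symmetryZ; [exact: smooth_j1ux|exact: contact_symmetry_ux].
rewrite (_ : (fun v => _) = fun v =>
    \sum_(b < n) c b * nth (fun _ => 0) (sym_basis m k) b v
    + c n * nth (fun _ => 0) (sym_basis m k) n v); last first.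
  by apply/funext => v; rewrite big_ord_recr.
have [s1 s2] := IH (ltnW nB); have [t1 t2] := S n nB.
split; first by apply: smoothD => //; exact: smoothZ.
by apply: contact_symmetryD => //; [exact: smoothZ|exact: contact_symmetryZ].
Qed.

(** [structure] leaves a symmetry [g] in x and y. Its prolongation is independent of [l], so it is
    tangent to F_k only if its derivatives of order [k] vanish. *)
Lemma span_contact_symmetry (R : realType) (m : R) k f : (2 < k)%N ->
  m != 0 -> m != 1 -> (forall i, (i <= k.+1)%N -> i%:R * m + 1 != 0) ->
  smooth f -> contact_symmetry m k f -> in_span (sym_basis m k) f.
Proof.
move=> k2 m0 m1 mk Hf Sf.
have mk' i : (i <= k)%N -> i%:R * m + 1 != 0 by move=> ik; apply: mk; lia.
have [a [b [c [e [g [Xg fE]]]]]] := structure k2 m0 m1 mk Hf Sf.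
have Srest : in_span (sym_basis m k)
    (fun v => a * j1ux v + (b * j1uy v + (c * scal1 m k v + e * scal2 m v))).
  by apply: in_spanD; [|apply: in_spanD; [|apply: in_spanD]]; apply: in_spanZ;
   [exact: (in_span_extra m k (t := 0))|exact: (in_span_extra m k (t := 1))
   |exact: (in_span_extra m k (t := 2))|exact: (in_span_extra m k (t := 3))].
rewrite fE; apply: in_spanD => //.
have srest : smooth (fun v => a * j1ux v + (b * j1uy v + (c * scal1 m k v + e * scal2 m v))).
  exact: (smoothD (smoothZ a (@smooth_j1ux R)) (smoothD (smoothZ b (@smooth_j1uy R))
    (smoothD (smoothZ c (smooth_scal1 m k)) (smoothZ e (smooth_scal2 m))))).
have Sg : contact_symmetry m k g.
  have -> : g = fun v => f v + (-1) * (a * j1ux v + (b * j1uy v + (c * scal1 m k v + e * scal2 m v))).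
    by apply/funext => v; rewrite fE; ring.
  apply: contact_symmetryD => //; first exact: smoothZ.
  by apply: contact_symmetryZ => //; exact: contact_symmetry_span.
have gk i v : (i <= k)%N -> iter (k - i) (pd 0) (iter i (pd 1) g) v = 0.
  pose G i := iter (k - i) (pd 0) (iter i (pd 1) g) v.
  have GE l j : 0 < l -> (j <= k)%N -> G j = G 0%N * l `^ (j%:R * m).
    move=> l0 jk; pose q := jcurve k m l (jof v 0 0 0).
    have Fq : inFk m k l q by exact: inFk_jcurve.
    have qv : proj1 q = v.
      rewrite -[RHS](proj1_jof v 0 0 0); apply: (@proj1_jagree R k.-1); first by lia.
      by apply: jagree_jcurve; lia.
    have := tangency k2 m0 m1 mk Sg Fq jk.
    by rewrite !(prol_coef_xyfun _ _ _ Xg) qv /G subn0.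
  (* The value of [G 1] at [l = 1] and [l = 2] gives [G 0 = G 0 * 2 ^ m], and [m] is nonzero. *)
  have G0 : G 0%N = 0.
    have k1 : (1 <= k)%N by lia.
    have := GE 1 1%N ltr01 k1; rewrite (GE 2 1%N (ltr0n _ 2) k1) powR1 mulr1 mul1r.
    move/eqP; rewrite -subr_eq0 -[X in _ - X]mulr1 -mulrBr mulf_eq0 => /orP[/eqP//|].
    rewrite subr_eq0 powR_eq1 (negbTE m0) orbF => /orP[/eqP h|]; lra.
  by move=> ik; rewrite -/(G i) (GE 1) // G0 mul0r.
have -> : g = fun v => \sum_(j < k) (\sum_(i < k - j)
     (iter i (pd 0) (iter j (pd 1) g) 0 / i`!%:R / j`!%:R) * xymono i j v).
  apply/funext => v; apply: xyfun_taylor => // i j ij w.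
  by rewrite (_ : i = (k - j)%N) ?gk//; lia.
apply: (in_span_sum (F := fun j v => \sum_(i < k - j)
     (iter i (pd 0) (iter j (pd 1) g) 0 / i`!%:R / j`!%:R) * xymono i j v)) => j jk.
apply: (in_span_sum (F := fun i v =>
     (iter i (pd 0) (iter j (pd 1) g) 0 / i`!%:R / j`!%:R) * xymono i j v)) => i ij.
by apply: in_spanZ; apply: in_span_xymono; lia.
Qed.

Theorem theorem4 (R : realType) (k : nat) (hk : (2 < k)%N) :
  exists S : seq R, forall m : R, m \notin S ->
    [/\ size (sym_basis m k) = (k * k.+1 %/ 2 + 4)%N,
        lin_indep (sym_basis m k) &
        forall f : J1 R -> R, smooth f ->
          (contact_symmetry m k f <-> in_span (sym_basis m k) f)].
Proof.
(* Generic means outside this finite set: 0, 1 and the roots of im + 1 for i from 1 to k + 1. *)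
exists [:: 0, 1 & [seq - (i.+1%:R)^-1 | i <- iota 0 k.+1]] => m.
rewrite in_cons negb_or in_cons negb_or => /and3P[m0 m1 mS].
have mk i : (i <= k.+1)%N -> i%:R * m + 1 != 0.
  case: i => [|i] ik; first by rewrite mul0r add0r oner_eq0.
  apply: contra mS; rewrite addr_eq0 => /eqP im; apply/mapP; exists i.
    by rewrite mem_iota.
  by rewrite -div1r -mulNr -im mulrC mulKf// pnatr_eq0.
split; first by rewrite size_sym_basis size_monomial_idx.
  exact: sym_basis_free.
move=> f Hf; split; first exact: span_contact_symmetry.
by apply: contact_symmetry_span => i ik; apply: mk; lia.
Qed.
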